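(* Let $\gamma>0$ and, for each integer $n>2$, let $r(n)>0$ be such that $n\,r(n)^2=2\gamma$. Let $X=a_1v_1+a_2v_2+a_3v_3\in\mathfrak h$ with $a_1,a_2,a_3\in\mathbb R$ and $(a_1,a_2)\neq(0,0)$. For $z\in\mathbb C$ let $\varphi_{f_z^\gamma}$ be the density of the spectral measure of the self-adjoint operator $-id\pi_\gamma(X)$ on $\mathcal H_\gamma$ associated with the unit vector $f_z^\gamma$, and for $w\in\mathbb D$ let $\varphi_{f_w^n}$ be the density of the spectral measure of the self-adjoint operator $-id\pi_n(C_{r(n)}(X))$ on $\mathcal H_n$ associated with the unit vector $f_w^n$. Then for each $\lambda\in\mathbb R$ and each $z\in\mathbb C$, $$\lim_{n\to+\infty}\varphi_{f^n_{z/\sqrt{2\gamma n}}}(\lambda)=\varphi_{f_z^\gamma}(\lambda),$$ where the left-hand side is considered for all $n$ large enough.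
   Context: Spectral measures and densities. If $A=\int\lambda\,dE_\lambda$ is self-adjoint on a Hilbert space and $f$ is a unit vector, the spectral measure of $A$ associated with $f$ is $\mu_f=d(\langle E_\lambda f,f\rangle)$. When $t\mapsto\langle\exp(-itA)f,f\rangle$ is integrable on $\mathbb R$, $\mu_f$ has density, and this density is taken to be the function $\varphi_f(\lambda)=\frac1{2\pi}\int_{\mathbb R}e^{it\lambda}\langle\exp(-itA)f,f\rangle\,dt$. For a unitary representation $\pi$ of a Lie group and $Y$ in its Lie algebra, $-id\pi(Y)$ denotes the self-adjoint operator $A$ with $\pi(\exp(tY))=\exp(itA)$ for all $t\in\mathbb R$. For the operators $-id\pi_n(C_{r(n)}(X))$ the density is considered for $n$ large enough (so that in particular $z/\sqrt{2\gamma n}\in\mathbb D$ and $r(n)^2a_3^2<a_1^2+a_2^2$). Heisenberg group. $\mathfrak h$ is the real Lie algebra with basis $v_1,v_2,v_3$ whose only non-trivial bracket is $[v_1,v_2]=v_3$; $H$ is the Heisenberg group, with elements $[a_1,a_2,a_3]=\exp_H(a_1v_1+a_2v_2+a_3v_3)$ and product $[a_1,a_2,a_3]\cdot[b_1,b_2,b_3]=[a_1+b_1,a_2+b_2,a_3+b_3+\frac12(a_1b_2-a_2b_1)]$. $\mathcal H_\gamma$ is the Hilbert space of entire functions $f$ on $\mathbb C$ with $\Vert f\Vert_\gamma^2=\int_{\mathbb C}|f(z)|^2e^{-|z|^2/2\gamma}(2\pi\gamma)^{-1}dx\,dy<\infty$ ($z=x+iy$). $H$ acts on $\mathbb C$ by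 $g\cdot z=z+\gamma(a_2-ia_1)$ for $g=[a_1,a_2,a_3]$, and $\pi_\gamma$ is the unitary representation of $H$ on $\mathcal H_\gamma$ given by $(\pi_\gamma(g)f)(z)=\alpha(g^{-1},z)f(g^{-1}\cdot z)$, where $\alpha(g,z)=\exp\left(-ia_3\gamma+\frac14(a_2+a_1i)(-2z+\gamma(-a_2+a_1i))\right)$. The coherent states are $e_z^\gamma(w)=\exp(\bar zw/2\gamma)$ and $f_z^\gamma:=\Vert e_z^\gamma\Vert_\gamma^{-1}e_z^\gamma$. $SU(1,1)$. $SU(1,1)$ is the group of matrices $g(a,b)=\begin{pmatrix}a&b\\ \bar b&\bar a\end{pmatrix}$ with $a,b\in\mathbb C$, $|a|^2-|b|^2=1$, acting on $\mathbb D=\{|z|<1\}$ by $g(a,b)\cdot z=\frac{az+b}{\bar bz+\bar a}$. Its Lie algebra $su(1,1)$ has basis $u_1=\frac12\begin{pmatrix}0&-i\\ i&0\end{pmatrix}$, $u_2=\frac12\begin{pmatrix}0&1\\1&0\end{pmatrix}$, $u_3=\frac12\begin{pmatrix}-i&0\\0&i\end{pmatrix}$. For an integer $n>2$, $\mathcal H_n$ is the Hilbert space of holomorphic functions $f$ on $\mathbb D$ with $\Vert f\Vert_n^2=\int_{\mathbb D}|f(z)|^2\frac{n-1}{\pi}(1-z\bar z)^{n-2}dx\,dy<\infty$, and $\pi_n$ is the unitary representation of $SU(1,1)$ on $\mathcal H_n$ given by $(\pi_n(g(a,b))f)(z)=(a-\bar bz)^{-n}f(g(a,b)^{-1}\cdot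 z)$. The coherent states are $e_z^n(w)=(1-w\bar z)^{-n}$ for $z,w\in\mathbb D$, and $f_z^n:=\Vert e_z^n\Vert_n^{-1}e_z^n$. Contraction. For $r>0$, $C_r:\mathfrak h\to su(1,1)$ is the linear map with $C_r(v_1)=ru_1$, $C_r(v_2)=ru_2$, $C_r(v_3)=r^2u_3$. *)

(* Defs.v *)
From HB Require Import structures.
From mathcomp Require Import all_boot all_order all_algebra.
From mathcomp Require Import complex.
From mathcomp Require Import all_classical all_reals all_analysis.

Set Implicit Arguments.
Unset Strict Implicit.
Unset Printing Implicit Defensive.

Import Order.TTheory GRing.Theory Num.Theory.
Import numFieldNormedType.Exports.

Local Open Scope classical_set_scope.
Local Open Scope ring_scope.
Local Open Scope complex_scope.

Section ComplexAnalysis.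
Context {R : realType}.
Local Notation C := R[i].

Definition cexp (z : C) : C :=
  (expR (complex.Re z))%:C *
  (cos (complex.Im z) +i* sin (complex.Im z)).

(* As for the integral of the library, [mu] is a plain set function, so that
   no measure structure has to be bundled in order to write an integral. *)
Definition cintegral d (T : measurableType d) (mu : set T -> \bar R)
    (D : set T) (f : T -> C) : C :=
  fine (\int[mu]_(x in D) (complex.Re (f x))%:E)%E +i*
  fine (\int[mu]_(x in D) (complex.Im (f x))%:E)%E.

Definition cintegrable d (T : measurableType d) (mu : set T -> \bar R)
    (D : set T) (f : T -> C) : Prop :=
  mu.-integrable D (fun x => (complex.Re (f x))%:E) /\
  mu.-integrable D (fun x => (complex.Im (f x))%:E).

(* Differentiability is taken over the field C, i.e. it is the existence of
   the complex derivative at each point. *)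
Definition holomorphic_on (D : set C) (f : C -> C) : Prop :=
  forall z, D z -> derivable (f : C^o -> C^o) z 1.

(* The Lebesgue measure dx dy of the plane; z = x + iy is p.1 +i* p.2. *)
Definition plane_measure : set (R * R) -> \bar R :=
  (lebesgue_measure \x lebesgue_measure)%E.

Definition expmx m (M : 'M[C]_m.+1) : 'M[C]_m.+1 :=
  lim (series (fun k => (k`!%:R^-1 : C) *: M ^+ k) @ \oo).

End ComplexAnalysis.

(* Hilbert spaces of functions are given as a subspace [space] of a complex
   vector space [V] together with an inner product [dot], linear in its first
   and conjugate-linear in its second argument; the values of [dot] outside
   [space] are irrelevant. *)
Record hilbert (R : realType) (V : lmodType R[i]) := Hilbert {
  space : set V;
  dot : V -> V -> R[i] }.

(* A possibly unbounded operator: [app] is only meaningful on [dom]. *)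
Record operator (V : Type) := Operator {
  dom : set V;
  app : V -> V }.

Section SpectralTheory.
Context {R : realType} {V : lmodType R[i]}.
Local Notation C := R[i].
Implicit Types (H : hilbert V) (A : operator V) (E : set R -> V -> V).

Definition hnorm H (u : V) : R := Num.sqrt (complex.Re (dot H u u)).

Definition hnormalize H (u : V) : V := ((hnorm H u)^-1)%:C *: u.

Definition selfadjoint H A : Prop :=
  [/\ dom A `<=` space H,
      (forall u, dom A u -> space H (app A u)),
      (forall (a : C) u v, dom A u -> dom A v ->
        dom A (a *: u + v) /\ app A (a *: u + v) = a *: app A u + app A v),
      (forall u, space H u -> forall e : R, 0 < e ->
        exists2 v, dom A v & hnorm H (u - v) < e) &
      (forall v w, space H v -> space H w ->
        (forall u, dom A u -> dot H (app A u) v = dot H u w) <->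
        dom A v /\ w = app A v)].

(* The set function B |-> <E(B)u, u>, i.e. d<E_lambda u, u>
   where E_lambda = E(]-oo, lambda]). *)
Definition spectral_measure H E (u : V) (B : set R) : \bar R :=
  (complex.Re (dot H (E B u) u))%:E.

(* Projection-valued measures on the Borel sets of the real line. *)
Definition resolution_of_identity H E : Prop :=
  [/\ (forall B (a : C) u v, measurable B -> space H u -> space H v ->
        space H (E B u) /\ E B (a *: u + v) = a *: E B u + E B v),
      (forall B u v, measurable B -> space H u -> space H v ->
        dot H (E B u) v = dot H u (E B v)),
      (forall B B' u, measurable B -> measurable B' -> space H u ->
        E B (E B' u) = E (B `&` B') u),
      (forall u, space H u -> E setT u = u) &
      (forall u, space H u -> semi_sigma_additive (spectral_measure H E u))].

(* The integral of g against d<E_lambda u, v>, by polarization. *)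
Definition spectral_integral H E (g : R -> C) (u v : V) : C :=
  4%:R^-1 * \sum_(k < 4)
    ('i%C ^+ k * cintegral (spectral_measure H E (u + 'i%C ^+ k *: v)) setT g).

(* A is the integral of lambda dE_lambda. *)
Definition is_spectral_resolution H A E : Prop :=
  [/\ resolution_of_identity H E,
      dom A = [set u | space H u /\
        (\int[spectral_measure H E u]_l (l ^+ 2)%:E < +oo)%E] &
      forall u v, dom A u -> dom A v ->
        dot H (app A u) v = spectral_integral H E (fun l => l%:C) u v].

(* exp(itA) u, where A is the integral of lambda dE_lambda: the vector of H
   representing v |-> \int exp(it lambda) d<E_lambda u, v>. *)
Definition exp_iA H E (t : R) (u : V) : V :=
  xget 0 [set w | space H w /\ forall v, space H v ->
    dot H w v =
      spectral_integral H E (fun l => cexp ('i%C * (t * l)%:C)) u v].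

(* A, with spectral resolution E, is the operator -i d/dt rho(t) at t = 0:
   rho(t) = exp(itA) for all t. By the theorems of Stone and von Neumann there
   is exactly one such A, and E is unique on Borel sets, as soon as rho is a
   strongly continuous unitary one-parameter group. *)
Definition is_generator H (rho : R -> V -> V) A E : Prop :=
  [/\ selfadjoint H A,
      is_spectral_resolution H A E &
      forall t u, space H u -> rho t u = exp_iA H E t u].

Definition spectral_coef H E (f : V) (t : R) : C :=
  dot H (exp_iA H E (- t) f) f.

(* The integrability condition under which the density is considered. *)
Definition spectral_coef_integrable H E (f : V) : Prop :=
  cintegrable lebesgue_measure setT (spectral_coef H E f).

Definition spectral_density H E (f : V) (l : R) : C :=
  ((2 * pi)^-1)%:C *
  cintegral lebesgue_measure setT
    (fun t => cexp ('i%C * (t * l)%:C) * spectral_coef H E f t).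

End SpectralTheory.

Section HeisenbergGroup.
Context {R : realType}.
Local Notation C := R[i].

(* The Heisenberg Lie algebra, in coordinates for the basis v1, v2, v3. *)
Definition v1 : 'rV[R]_3 := delta_mx 0 0.
Definition v2 : 'rV[R]_3 := delta_mx 0 1.
Definition v3 : 'rV[R]_3 := delta_mx 0 2%:R.

Record heis := Heis { h1 : R; h2 : R; h3 : R }.

Definition heis_mul (g h : heis) : heis :=
  Heis (h1 g + h1 h) (h2 g + h2 h)
    (h3 g + h3 h + (h1 g * h2 h - h2 g * h1 h) / 2).

Definition heis_inv (g : heis) : heis := Heis (- h1 g) (- h2 g) (- h3 g).

Lemma heis_mulVg g : heis_mul (heis_inv g) g = Heis 0 0 0.
Proof. by rewrite /heis_mul /= !addNr !mulNr opprK (mulrC (h1 g)) addNr mul0r addr0. Qed.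

Definition exp_heis (X : 'rV[R]_3) : heis := Heis (X 0 0) (X 0 1) (X 0 2%:R).

Variable gamma : R.

Definition fock_dot (f g : C -> C^o) : C :=
  cintegral plane_measure setT (fun p => let z := p.1 +i* p.2 in
    f z * (g z)^* *
    (expR (- (Normc.normc z ^+ 2 / (2 * gamma))) / (2 * pi * gamma))%:C).

Definition fock_space : set (C -> C^o) :=
  [set f | holomorphic_on setT f /\
    (\int[plane_measure]_(p in setT) (let z := (p.1 +i* p.2)%C in
      Normc.normc (f z) ^+ 2 *
      expR (- (Normc.normc z ^+ 2 / (2 * gamma))) / (2 * pi * gamma))%:E
      < +oo)%E].

Definition fock : hilbert (C -> C^o) := Hilbert fock_space fock_dot.

Definition heis_act (g : heis) (z : C) : C :=
  z + gamma%:C * ((h2 g)%:C - 'i%C * (h1 g)%:C).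

Definition heis_alpha (g : heis) (z : C) : C :=
  cexp (- 'i%C * (h3 g * gamma)%:C +
        4%:R^-1 * ((h2 g)%:C + (h1 g)%:C * 'i%C) *
        (- 2%:R * z + gamma%:C * (- (h2 g)%:C + (h1 g)%:C * 'i%C))).

Definition fock_rep (g : heis) (f : C -> C^o) : C -> C^o :=
  fun z => heis_alpha (heis_inv g) z * f (heis_act (heis_inv g) z).

Definition fock_state (z : C) : C -> C^o :=
  fun w => cexp (z^* * w / (2 * gamma)%:C).

Definition fock_unit_state (z : C) : C -> C^o := hnormalize fock (fock_state z).

End HeisenbergGroup.

Section SU11.
Context {R : realType}.
Local Notation C := R[i].

Definition mx2 (a b c d : C) : 'M[C]_2 :=
  \matrix_(i, j) if i == 0 then (if j == 0 then a else b)
                 else (if j == 0 then c else d).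

Definition u1 : 'M[C]_2 := 2%:R^-1 *: mx2 0 (- 'i%C) 'i%C 0.
Definition u2 : 'M[C]_2 := 2%:R^-1 *: mx2 0 1 1 0.
Definition u3 : 'M[C]_2 := 2%:R^-1 *: mx2 (- 'i%C) 0 0 'i%C.

Definition lie_contraction (r : R) (X : 'rV[R]_3) : 'M[C]_2 :=
  (X 0 0 * r)%:C *: u1 + (X 0 1 * r)%:C *: u2 + (X 0 2%:R * r ^+ 2)%:C *: u3.

Definition su11_act (g : 'M[C]_2) (z : C) : C :=
  (g 0 0 * z + g 0 1) / (g 1 0 * z + g 1 1).

Variable n : nat.

Definition disc : set C := [set z | `|z| < 1].

Definition plane_disc : set (R * R) := [set p | disc (p.1 +i* p.2)].

Definition disc_dot (f g : C -> C^o) : C :=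
  cintegral plane_measure plane_disc (fun p => let z := p.1 +i* p.2 in
    f z * (g z)^* *
    ((n.-1)%:R / pi * (1 - Normc.normc z ^+ 2) ^+ (n - 2))%:C).

(* Functions on the disc are represented by their extension by 0 to C. *)
Definition disc_space : set (C -> C^o) :=
  [set f | [/\ holomorphic_on disc f,
    (forall z, ~ disc z -> f z = 0) &
    (\int[plane_measure]_(p in plane_disc) (let z := (p.1 +i* p.2)%C in
      Normc.normc (f z) ^+ 2 *
      ((n.-1)%:R / pi * (1 - Normc.normc z ^+ 2) ^+ (n - 2)))%:E < +oo)%E]].

Definition disc_hilbert : hilbert (C -> C^o) := Hilbert disc_space disc_dot.

(* For g = g(a, b), the first row of g is (a, b). *)
Definition disc_rep (g : 'M[C]_2) (f : C -> C^o) : C -> C^o :=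
  fun z => if `|z| < 1 then
    (g 0 0 - (g 0 1)^* * z) ^- n * f (su11_act (invmx g) z) else 0.

Definition disc_state (z : C) : C -> C^o :=
  fun w => if `|w| < 1 then (1 - w * z^*) ^- n else 0.

Definition disc_unit_state (z : C) : C -> C^o :=
  hnormalize disc_hilbert (disc_state z).

End SU11.

(* Main.v *)
Require Import Defs.
From HB Require Import structures.
From mathcomp Require Import all_boot all_order all_algebra.
From mathcomp Require Import complex.
From mathcomp Require Import all_classical all_reals all_analysis.
From mathcomp Require Import measurable_realfun.
From mathcomp Require Import ring lra.

(** Since [rho t = exp (itA)], the function [t |-> <exp (-itA) f, f>] is the matrix
coefficient [<rho (-t) f, f>] ([spectral_coef_generator]). Both densities are
therefore Fourier transforms of matrix coefficients of coherent states, which can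
be computed in closed form; the theorem is then a case of dominated convergence.

Each group maps a coherent state to a multiple of a kernel of the same shape, so
the coefficients reduce to inner products of such kernels. In the Fock space
these are complex Gaussian integrals ([cintegral_gauss]), reduced to real ones by
shifting the contour. In the weighted Bergman space they are given by
[[
  I ((1 - |z|^2)^N (1 - w z^* )^-(N+2) (A - B z)^-(N+2)) = (A - B w)^-(N+2) I ((1 - |z|^2)^N)
]]
where [I] is the integral over the disc ([cintegral_kernel]). That follows from
Green's formula for the Cauchy-Riemann operator ([disc_green]):
[(1 - |z|^2)^N (1 - w z^* )^-(N+2) (w - z)] times a holomorphic function is the
Cauchy-Riemann derivative of a function vanishing on the circle. The total masses
of the two weights cancel when the states are normalised.

Put [rho2 = a1^2 + a2^2], [theta = - (gamma a3 + a1 Re z + a2 Im z)] and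
[s^2 = r^2 (rho2 - r^2 a3^2) / 4]. The square of the matrix [C_r(X)] is the scalar
[s^2], so its exponential is expressed by [cosh] and [sinh], and the coefficients are
[[
  F(t)   = exp (- gamma rho2 t^2 / 4 + i theta t),
  F_n(t) = (cosh (s t) + i kappa sinh (s t) / s)^-n
]]
for a real number [kappa] depending on [n] ([fock_spectral_coef],
[disc_spectral_coef]). As [n] grows, [n s^2] tends to [gamma rho2 / 2] and [n kappa]
to [- theta], so that [F_n(t)] tends to [F(t)] by the limit [(1 + c_n)^n -> exp L]
valid when [n c_n -> L] ([cvg_compound]). Moreover [cosh y >= 1 + y^2 / 2] and
Bernoulli's inequality give [|F_n(t)| <= (1 + n s^2 t^2 / 2)^-1], and [n s^2] is
bounded below by a positive constant because [(a1, a2)] is nonzero; so a multiple of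
[(1 + t^2)^-1] dominates [F] and all the [F_n] with [n] large ([disc_coef_bound]). *)

Set Implicit Arguments.
Unset Strict Implicit.
Unset Printing Implicit Defensive.

Import Order.TTheory GRing.Theory Num.Theory.
Import numFieldNormedType.Exports.

Local Open Scope classical_set_scope.
Local Open Scope ring_scope.
Local Open Scope complex_scope.
Local Open Scope ring_scope.

Local Notation Re := complex.Re.
Local Notation Im := complex.Im.
Local Notation normc := Normc.normc.

(** * Complex numbers and the complex exponential *)

Section ComplexNumbers.
Context {R : realType}.
Local Notation C := R[i].
Implicit Types x y z : C.

Lemma eq_cpx x y : Re x = Re y -> Im x = Im y -> x = y.
Proof. by case: x y => a b [c d] /= -> ->. Qed.

Lemma cReD x y : Re (x + y) = Re x + Re y. Proof. by case: x y => a b []. Qed.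
Lemma cImD x y : Im (x + y) = Im x + Im y. Proof. by case: x y => a b []. Qed.
Lemma cReN x : Re (- x) = - Re x. Proof. by case: x. Qed.
Lemma cImN x : Im (- x) = - Im x. Proof. by case: x. Qed.
Lemma cReM x y : Re (x * y) = Re x * Re y - Im x * Im y.
Proof. by case: x y => a b []. Qed.
Lemma cImM x y : Im (x * y) = Re x * Im y + Im x * Re y.
Proof. by case: x y => a b []. Qed.
Lemma cReV x : Re (x^-1) = Re x / (Re x ^+ 2 + Im x ^+ 2).
Proof. by case: x. Qed.
Lemma cImV x : Im (x^-1) = - Im x / (Re x ^+ 2 + Im x ^+ 2).
Proof. by case: x => a b /=; rewrite mulNr. Qed.
Lemma cReJ x : Re x^* = Re x. Proof. by case: x. Qed.
Lemma cImJ x : Im x^* = - Im x. Proof. by case: x. Qed.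
Lemma cReMr (a : R) x : Re (a%:C * x) = a * Re x.
Proof. by rewrite cReM /= mul0r subr0. Qed.
Lemma cImMr (a : R) x : Im (a%:C * x) = a * Im x.
Proof. by rewrite cImM /= mul0r addr0. Qed.

Definition cReImE := (cReD, cImD, cReN, cImN, cReMr, cImMr, cReM, cImM, cReJ, cImJ).

Lemma normcE2 x : normc x ^+ 2 = Re x ^+ 2 + Im x ^+ 2.
Proof. by case: x => a b /=; rewrite sqr_sqrtr// addr_ge0 ?sqr_ge0. Qed.

Lemma normc_ge0 x : 0 <= normc x.
Proof. by case: x => a b; exact: sqrtr_ge0. Qed.

Lemma normr_normc x : `|x| = (normc x)%:C.
Proof. by rewrite normc_def; case: x. Qed.

Lemma ltr_normc x (e : R) : (`|x| < e%:C) = (normc x < e).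
Proof. by rewrite normr_normc ltcR. Qed.

Lemma normc_lt1 x : (`|x| < 1) = (normc x < 1).
Proof. exact: (ltr_normc x 1). Qed.

Lemma normc_real (a : R) : normc a%:C = `|a|.
Proof. by rewrite /= expr0n/= addr0 sqrtr_sqr. Qed.

Lemma normc_conj x : normc x^* = normc x.
Proof. by case: x => a b /=; rewrite sqrrN. Qed.

Lemma normc_opp x : normc (- x) = normc x.
Proof. by case: x => a b /=; rewrite !sqrrN. Qed.

Lemma normcX x n : normc (x ^+ n) = normc x ^+ n.
Proof.
elim: n => [|n IH]; first by rewrite !expr0 Normc.normc1.
by rewrite !exprS Normc.normcM IH.
Qed.

Lemma normc_gt0 x : (0 < normc x) = (x != 0).
Proof.
rewrite lt_neqAle normc_ge0 andbT eq_sym; congr (~~ _).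
by apply/eqP/eqP => [/Normc.eq0_normc|->]; rewrite ?Normc.normc0.
Qed.

Lemma Re_le_normc x : `|Re x| <= normc x.
Proof.
rewrite -(@ler_pXn2r _ 2) ?nnegrE ?normc_ge0//.
by rewrite normcE2 real_normK ?num_real// lerDl sqr_ge0.
Qed.

Lemma Im_le_normc x : `|Im x| <= normc x.
Proof.
rewrite -(@ler_pXn2r _ 2) ?nnegrE ?normc_ge0//.
by rewrite normcE2 real_normK ?num_real// lerDr sqr_ge0.
Qed.

Lemma normc_leD x y : normc (x + y) <= normc x + normc y.
Proof. exact: le_normcD. Qed.

Lemma normc_leB x y : normc (x - y) <= normc x + normc y.
Proof. by rewrite -(normc_opp y); exact: normc_leD. Qed.

Lemma normc_geB x y : normc x - normc y <= normc (x - y).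
Proof.
by rewrite lerBlDr; apply: le_trans (normc_leD _ _); rewrite subrK.
Qed.

Lemma normc_le_ReIm x : normc x <= `|Re x| + `|Im x|.
Proof.
case: x => a b; rewrite -(@ler_pXn2r _ 2) ?nnegrE ?normc_ge0 ?addr_ge0//.
rewrite normcE2 /= sqrrD !real_normK ?num_real//.
by rewrite addrAC lerDl mulrn_wge0// mulr_ge0.
Qed.

Lemma normc_sum I (r : seq I) (P : pred I) (f : I -> C) :
  normc (\sum_(i <- r | P i) f i) <= \sum_(i <- r | P i) normc (f i).
Proof.
elim/big_ind2 : _ => [|x a y b xa yb|//]; first by rewrite Normc.normc0.
exact: le_trans (normc_leD _ _) (lerD xa yb).
Qed.

Lemma Re_realc (a : R) : Re a%:C = a. Proof. by []. Qed.

Lemma realcM (a b : R) : (a * b)%:C = a%:C * b%:C :> C.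
Proof. exact: rmorphM. Qed.

Lemma realc_sum I (r : seq I) (P : pred I) (f : I -> R) :
  (\sum_(i <- r | P i) f i)%:C = \sum_(i <- r | P i) (f i)%:C :> C.
Proof. by apply: (big_morph (fun a : R => a%:C)) => // a b; exact: rmorphD. Qed.

Lemma realcV (a : R) : (a^-1)%:C = (a%:C)^-1 :> C.
Proof. exact: fmorphV. Qed.

Lemma conjcM x y : (x * y)^* = x^* * y^*.
Proof. exact: rmorphM. Qed.

Lemma realcB (a b : R) : (a - b)%:C = a%:C - b%:C :> C.
Proof. exact: rmorphB. Qed.

Lemma realc1 : 1%:C = 1 :> C. Proof. by []. Qed.

Lemma realcX (a : R) n : (a ^+ n)%:C = a%:C ^+ n :> C.
Proof. exact: rmorphXn. Qed.

Lemma conjcD x y : (x + y)^* = x^* + y^*.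
Proof. exact: rmorphD. Qed.

Lemma conjcB x y : (x - y)^* = x^* - y^*.
Proof. exact: rmorphB. Qed.

Lemma conjcXn x n : (x ^+ n)^* = x^* ^+ n.
Proof. exact: rmorphXn. Qed.

Lemma conjcV x : (x^-1)^* = (x^*)^-1.
Proof. exact: fmorphV. Qed.

Lemma conjc_one : 1^* = 1 :> C.
Proof. exact: rmorph1. Qed.

Lemma conjc_realc (a : R) : (a%:C)^* = a%:C :> C.
Proof. by apply: eq_cpx; rewrite //= oppr0. Qed.

Lemma realc_eq0 (a : R) : (a%:C == 0 :> C) = (a == 0).
Proof. exact: (fmorph_eq0 (@real_complex_def R _)). Qed.

Lemma mulcJ x : x * x^* = (normc x ^+ 2)%:C.
Proof.
apply: eq_cpx; rewrite ?cReM ?cImM ?cReJ ?cImJ /=; last by ring.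
by rewrite normcE2; ring.
Qed.

Lemma cexpD x y : cexp (x + y) = cexp x * cexp y.
Proof.
apply: eq_cpx; rewrite /cexp !cReImE /=.
  by rewrite expRD cosD ?sinD; ring.
by rewrite expRD ?cosD sinD; ring.
Qed.

Lemma cexp0 : cexp 0 = 1 :> C.
Proof. by apply: eq_cpx; rewrite /cexp ?cReImE/= expR0 ?cos0 ?sin0 ?mul1r ?mulr0. Qed.

Lemma normc_cexp x : normc (cexp x) = expR (Re x).
Proof.
rewrite /cexp Normc.normcM normc_real ger0_norm ?expR_ge0//=.
by rewrite cos2Dsin2 sqrtr1 mulr1.
Qed.

Lemma cexp_neq0 x : cexp x != 0.
Proof. by rewrite -normc_gt0 normc_cexp expR_gt0. Qed.

Lemma cexpN x : cexp (- x) = (cexp x)^-1.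
Proof.
apply: (mulIf (cexp_neq0 x)).
by rewrite -cexpD addNr cexp0 mulVf ?cexp_neq0.
Qed.

Lemma cexpJ x : (cexp x)^* = cexp x^*.
Proof. by apply: eq_cpx; rewrite /cexp !cReImE/= ?cosN ?sinN ?mulrN. Qed.

Lemma cexpMn x n : cexp (x *+ n) = cexp x ^+ n.
Proof.
elim: n => [|n IH]; first by rewrite mulr0n cexp0.
by rewrite mulrS cexpD IH exprS.
Qed.

Lemma cexp_real (a : R) : cexp a%:C = (expR a)%:C.
Proof. by apply: eq_cpx; rewrite /cexp ?cReImE/= ?cos0 ?sin0 ?mulr1 ?mulr0. Qed.

End ComplexNumbers.

(** * Complex-valued functions of a real variable *)

Section ComplexDerivative.
Context {R : realType}.
Local Notation C := R[i].
Implicit Types (f g : R -> C) (t : R).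

(** Differentiability of the real and imaginary parts: the mean value theorem and
the fundamental theorem of calculus are applied to each of them. *)
Definition is_cderive f t (l : C) : Prop :=
  is_derive t 1 (fun s => Re (f s)) (Re l) /\
  is_derive t 1 (fun s => Im (f s)) (Im l).

Lemma is_cderive_eq f t l l' : is_cderive f t l -> l = l' -> is_cderive f t l'.
Proof. by move=> h <-. Qed.

Lemma is_cderive_cst (a : C) t : is_cderive (fun=> a) t 0.
Proof. by split; exact: is_derive_cst. Qed.

Lemma is_cderiveD f g t l m : is_cderive f t l -> is_cderive g t m ->
  is_cderive (fun s => f s + g s) t (l + m).
Proof.
move=> [fr fi] [gr gi]; split; rewrite ?cReD ?cImD.
  have -> : (fun s => Re (f s + g s)) = (fun s => Re (f s)) + (fun s => Re (g s)).
    by apply/funext => s; rewrite cReD.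
  exact: is_deriveD.
have -> : (fun s => Im (f s + g s)) = (fun s => Im (f s)) + (fun s => Im (g s)).
  by apply/funext => s; rewrite cImD.
exact: is_deriveD.
Qed.

Lemma is_cderiveN f t l : is_cderive f t l -> is_cderive (fun s => - f s) t (- l).
Proof.
move=> [fr fi]; split; rewrite ?cReN ?cImN.
  have -> : (fun s => Re (- f s)) = - (fun s => Re (f s)).
    by apply/funext => s; rewrite cReN.
  exact: is_deriveN.
have -> : (fun s => Im (- f s)) = - (fun s => Im (f s)).
  by apply/funext => s; rewrite cImN.
exact: is_deriveN.
Qed.

Lemma is_cderiveB f g t l m : is_cderive f t l -> is_cderive g t m ->
  is_cderive (fun s => f s - g s) t (l - m).
Proof. by move=> hf hg; apply: is_cderiveD => //; exact: is_cderiveN. Qed.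

Lemma is_cderiveM f g t l m : is_cderive f t l -> is_cderive g t m ->
  is_cderive (fun s => f s * g s) t (l * g t + f t * m).
Proof.
move=> [fr fi] [gr gi]; split.
  have -> : (fun s => Re (f s * g s)) = (fun s => Re (f s)) * (fun s => Re (g s)) -
      (fun s => Im (f s)) * (fun s => Im (g s)).
    by apply/funext => s; rewrite cReM.
  apply: is_derive_eq; rewrite /GRing.scale/= !cReImE; ring.
have -> : (fun s => Im (f s * g s)) = (fun s => Re (f s)) * (fun s => Im (g s)) +
    (fun s => Im (f s)) * (fun s => Re (g s)).
  by apply/funext => s; rewrite cImM.
apply: is_derive_eq; rewrite /GRing.scale/= !cReImE; ring.
Qed.

Lemma is_cderiveX f t l n : is_cderive f t l ->
  is_cderive (fun s => f s ^+ n) t (n%:R * f t ^+ n.-1 * l).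
Proof.
move=> hf; elim: n => [|n IH].
  by rewrite !mul0r; exact: (is_cderive_cst 1).
have -> : (fun s => f s ^+ n.+1) = (fun s => f s * f s ^+ n).
  by apply/funext => s; rewrite exprS.
apply: (is_cderive_eq (is_cderiveM hf IH)).
case: n {IH} => [|n] /=; first by rewrite !expr0; ring.
by rewrite exprS -[in RHS]natr1; ring.
Qed.

Lemma is_derive_real (f : R -> R) t l : is_derive t 1 f l ->
  is_cderive (fun s => (f s)%:C) t l%:C.
Proof. by move=> h; split => //=; exact: is_derive_cst. Qed.

Lemma is_cderiveJ f t l : is_cderive f t l ->
  is_cderive (fun s => (f s)^*) t l^*.
Proof.
move=> [gr gi]; split; rewrite ?cReJ ?cImJ.
  by under [X in is_derive _ _ X]eq_fun do rewrite cReJ.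
have -> : (fun s => Im (f s)^*) = - (fun s => Im (f s)).
  by apply/funext => s; rewrite cImJ.
exact: is_deriveN.
Qed.

(** [1 / f = f^* / |f|^2] reduces the reciprocal to that of a real function. *)
Lemma is_cderiveV f t l : f t != 0 -> is_cderive f t l ->
  is_cderive (fun s => (f s)^-1) t (- (f t) ^- 2 * l).
Proof.
move=> f0 hf.
have J g m := @is_cderiveJ g t m.
have E s : (f s)^-1 = ((Re (f s * (f s)^*))^-1)%:C * (f s)^*.
  rewrite mulcJ/=; have [->|n0] := eqVneq (f s) 0.
    by rewrite invr0; apply: eq_cpx; rewrite !cReImE/= ?mulr0// oppr0 mulr0.
  apply: (mulfI n0); rewrite mulfV// mulrCA mulcJ -rmorphM/= mulVf//.
  by rewrite expf_neq0// gt_eqF// normc_gt0.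
under [X in is_cderive X]eq_fun do rewrite E.
have := is_cderiveM hf (J _ _ hf) => -[hr _].
have nz : Re (f t * (f t)^*) != 0.
  by rewrite mulcJ /= expf_neq0// gt_eqF// normc_gt0.
have hV := is_derive_real (is_deriveV nz hr).
apply: (is_cderive_eq (is_cderiveM hV (J _ _ hf))).
have JJ : ((normc (f t) ^+ 2)%:C) = f t * (f t)^* by rewrite mulcJ.
have Jn0 : (f t)^* != 0 by rewrite fmorph_eq0.
have Eh : (Re (l * (f t)^* + f t * l^*))%:C = l * (f t)^* + f t * l^*.
  by apply: eq_cpx; rewrite // !cReImE; ring.
rewrite /GRing.scale/= rmorphM/= rmorphN/= Eh fmorphV rmorphXn /=.
rewrite fmorphV mulcJ /= JJ.
by field; rewrite f0 Jn0.
Qed.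

Lemma is_cderive_id t : is_cderive (fun s => s%:C) t 1.
Proof. by apply: (@is_derive_real id t 1); exact: is_derive_id. Qed.

Lemma is_cderive_cexp f t l : is_cderive f t l ->
  is_cderive (fun s => cexp (f s)) t (l * cexp (f t)).
Proof.
move=> [fr fi].
have he : is_cderive (fun s => (expR (Re (f s)))%:C) t (expR (Re (f t)) * Re l)%:C.
  exact: (@is_derive_real (fun s => expR (Re (f s)))).
have hc : is_cderive (fun s => cos (Im (f s)) +i* sin (Im (f s))) t
   ((- sin (Im (f t)) * Im l) +i* (cos (Im (f t)) * Im l)).
  by split; apply: is_derive1_comp.
apply: (is_cderive_eq (is_cderiveM he hc)).
by apply: eq_cpx; rewrite /cexp !cReImE/= ?cReImE/=; ring.
Qed.

End ComplexDerivative.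

(** * Measurable and integrable complex-valued functions *)

Section ComplexMeasurable.
Context {R : realType} d (T : measurableType d).
Local Notation C := R[i].
Implicit Types f g : T -> C.

Definition measurable_cfun f : Prop :=
  measurable_fun setT (fun x => Re (f x)) /\
  measurable_fun setT (fun x => Im (f x)).

Lemma measurable_cfun_cst (a : C) : measurable_cfun (fun=> a).
Proof. by split. Qed.

Lemma measurable_cfun_real (h : T -> R) : measurable_fun setT h ->
  measurable_cfun (fun x => (h x)%:C).
Proof. by move=> mh; split => //=. Qed.

Lemma measurable_cfunD f g : measurable_cfun f -> measurable_cfun g ->
  measurable_cfun (fun x => f x + g x).
Proof.
move=> [fr fi] [gr gi]; split.
  by under eq_fun do rewrite cReD; exact: measurable_funD.
by under eq_fun do rewrite cImD; exact: measurable_funD.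
Qed.

Lemma measurable_cfunN f : measurable_cfun f -> measurable_cfun (fun x => - f x).
Proof.
move=> [fr fi]; split.
  by under eq_fun do rewrite cReN; exact: measurable_funN.
by under eq_fun do rewrite cImN; exact: measurable_funN.
Qed.

Lemma measurable_cfunB f g : measurable_cfun f -> measurable_cfun g ->
  measurable_cfun (fun x => f x - g x).
Proof. by move=> mf mg; apply: measurable_cfunD => //; exact: measurable_cfunN. Qed.

Lemma measurable_cfunM f g : measurable_cfun f -> measurable_cfun g ->
  measurable_cfun (fun x => f x * g x).
Proof.
move=> [fr fi] [gr gi]; split.
  under eq_fun do rewrite cReM.
  by apply: measurable_funB; exact: measurable_funM.
under eq_fun do rewrite cImM.
by apply: measurable_funD; exact: measurable_funM.
Qed.

Lemma measurable_cfunX f n : measurable_cfun f ->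
  measurable_cfun (fun x => f x ^+ n).
Proof.
move=> mf; elim: n => [|n IH]; first exact: (measurable_cfun_cst 1).
by under [X in measurable_cfun X]eq_fun do rewrite exprS; exact: measurable_cfunM.
Qed.

Lemma measurable_cfunJ f : measurable_cfun f -> measurable_cfun (fun x => (f x)^*).
Proof.
move=> [fr fi]; split; first by under eq_fun do rewrite cReJ.
by under eq_fun do rewrite cImJ; exact: measurable_funN.
Qed.

Lemma measurable_cfunV f : measurable_cfun f -> measurable_cfun (fun x => (f x)^-1).
Proof.
move=> [fr fi].
(* Inversion is discontinuous at 0; the real power of exponent -1 is measurable
   everywhere and agrees with it on nonnegative numbers. *)
have mV : measurable_fun setT (fun x => (Re (f x) ^+ 2 + Im (f x) ^+ 2)^-1).
  have -> : (fun x => (Re (f x) ^+ 2 + Im (f x) ^+ 2)^-1) =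
      (@powR R ^~ (-1)) \o (fun x => Re (f x) ^+ 2 + Im (f x) ^+ 2).
    apply/funext => x /=; rewrite powRN powRr1// addr_ge0// sqr_ge0//.
  apply: measurableT_comp; first exact: measurable_powR.
  by apply: measurable_funD; exact: measurable_funX.
split.
  by under eq_fun do rewrite cReV; exact: measurable_funM.
under eq_fun do rewrite cImV; apply: measurable_funM => //.
exact: measurable_funN.
Qed.

Lemma measurable_cfun_cexp f : measurable_cfun f ->
  measurable_cfun (fun x => cexp (f x)).
Proof.
move=> [fr fi].
have me : measurable_fun setT (fun x => expR (Re (f x))).
  by apply: measurableT_comp => //; exact: measurable_expR.
have mc : measurable_fun setT (fun x => cos (Im (f x))).
  by apply: measurableT_comp => //; apply: continuous_measurable_fun; exact: continuous_cos.
have ms : measurable_fun setT (fun x => sin (Im (f x))).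
  by apply: measurableT_comp => //; apply: continuous_measurable_fun; exact: continuous_sin.
by apply: measurable_cfunM; [exact: measurable_cfun_real|split].
Qed.

End ComplexMeasurable.

Section ComplexIntegral.
Context {R : realType} d (T : measurableType d).
Variables (mu : {measure set T -> \bar R}) (D : set T).
Hypothesis mD : measurable D.
Local Notation C := R[i].
Implicit Types f g : T -> C.

Lemma eq_cintegral f g : (forall x, D x -> f x = g x) ->
  cintegral mu D f = cintegral mu D g.
Proof.
move=> fg; rewrite /cintegral; congr (fine _ +i* fine _).
  by apply: eq_integral => x /set_mem Dx; rewrite fg.
by apply: eq_integral => x /set_mem Dx; rewrite fg.
Qed.

Lemma cintegrable_le f (h : T -> R) : measurable_cfun f ->
  mu.-integrable D (EFin \o h) -> (forall x, D x -> normc (f x) <= h x) ->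
  cintegrable mu D f.
Proof.
move=> [fr fi] ih fh; split.
  apply: le_integrable ih => //.
    by apply/measurable_EFinP; exact: measurable_funTS.
  move=> x Dx /=; rewrite lee_fin.
  exact: le_trans (le_trans (Re_le_normc _) (fh x Dx)) (ler_norm _).
apply: le_integrable ih => //.
  by apply/measurable_EFinP; exact: measurable_funTS.
move=> x Dx /=; rewrite lee_fin.
exact: le_trans (le_trans (Im_le_normc _) (fh x Dx)) (ler_norm _).
Qed.

Lemma cintegrableD f g : cintegrable mu D f -> cintegrable mu D g ->
  cintegrable mu D (fun x => f x + g x).
Proof.
move=> [fr fi] [gr gi]; split.
  by under eq_fun do rewrite cReD EFinD; exact: integrableD.
by under eq_fun do rewrite cImD EFinD; exact: integrableD.
Qed.

Lemma cintegralD f g : cintegrable mu D f -> cintegrable mu D g ->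
  cintegral mu D (fun x => f x + g x) = cintegral mu D f + cintegral mu D g.
Proof.
move=> [fr fi] [gr gi]; apply: eq_cpx; rewrite ?cReD ?cImD /cintegral/=.
  under eq_integral do rewrite cReD EFinD.
  by rewrite integralD// fineD//; exact: integrable_fin_num.
under eq_integral do rewrite cImD EFinD.
by rewrite integralD// fineD//; exact: integrable_fin_num.
Qed.

Lemma cintegrableZl (a : C) f : cintegrable mu D f ->
  cintegrable mu D (fun x => a * f x).
Proof.
move=> [fr fi]; split.
  under eq_fun do rewrite cReM EFinB !EFinM.
  by apply: integrableB => //; exact: integrableZl.
under eq_fun do rewrite cImM EFinD !EFinM.
by apply: integrableD => //; exact: integrableZl.
Qed.

Lemma cintegralZl (a : C) f : cintegrable mu D f ->
  cintegral mu D (fun x => a * f x) = a * cintegral mu D f.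
Proof.
move=> [fr fi]; apply: eq_cpx; rewrite ?cReM ?cImM /cintegral/=.
  under eq_integral do rewrite cReM EFinB !EFinM.
  rewrite integralB//; [|exact: integrableZl..].
  rewrite !integralZl// fineB ?fineM//; by rewrite ?fin_numM//; exact: integrable_fin_num.
under eq_integral do rewrite cImM EFinD !EFinM.
rewrite integralD//; [|exact: integrableZl..].
rewrite !integralZl// fineD ?fineM//; by rewrite ?fin_numM//; exact: integrable_fin_num.
Qed.

Lemma cintegral0 : cintegral mu D (fun=> 0 : C) = 0.
Proof. by apply: eq_cpx; rewrite /cintegral/= integral0. Qed.

Lemma cintegrable0 : cintegrable mu D (fun=> 0 : C).
Proof. by split; exact: integrable0. Qed.

Lemma cintegrable_sum I (r : seq I) (F : I -> T -> C) :
  (forall i, cintegrable mu D (F i)) ->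
  cintegrable mu D (fun x => \sum_(i <- r) F i x).
Proof.
move=> h; elim: r => [|i r IH].
  by under [X in cintegrable _ _ X]eq_fun do rewrite big_nil; exact: cintegrable0.
under [X in cintegrable _ _ X]eq_fun do rewrite big_cons.
exact: cintegrableD.
Qed.

Lemma cintegral_sum I (r : seq I) (F : I -> T -> C) :
  (forall i, cintegrable mu D (F i)) ->
  cintegral mu D (fun x => \sum_(i <- r) F i x) =
  \sum_(i <- r) cintegral mu D (F i).
Proof.
move=> h; elim: r => [|i r IH].
  by rewrite big_nil; under [X in cintegral _ _ X]eq_fun do rewrite big_nil; exact: cintegral0.
rewrite big_cons -IH; under [X in cintegral _ _ X]eq_fun do rewrite big_cons.
by apply: cintegralD => //; exact: cintegrable_sum.
Qed.

Lemma cintegralJ f : cintegrable mu D f ->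
  cintegral mu D (fun x => (f x)^*) = (cintegral mu D f)^*.
Proof.
move=> [fr fi]; apply: eq_cpx; rewrite ?cReJ ?cImJ /cintegral/=.
  by under eq_integral do rewrite cReJ.
under eq_integral do rewrite cImJ EFinN.
by rewrite integralN ?fineN//; exact: integrable_add_def.
Qed.

Lemma cintegral_eq0 f : (\int[mu]_(x in D) (Re (f x))%:E = 0)%E ->
  (\int[mu]_(x in D) (Im (f x))%:E = 0)%E -> cintegral mu D f = 0.
Proof. by rewrite /cintegral => -> ->. Qed.

End ComplexIntegral.

(** * Lebesgue measure on the plane *)

Section ComplexFubini.
Context {R : realType}.
Local Notation C := R[i].
Local Notation mu := (@lebesgue_measure R).

Lemma integrable_prod_fun (f g : R -> R) :
  mu.-integrable setT (EFin \o f) -> mu.-integrable setT (EFin \o g) ->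
  (mu \x mu)%E.-integrable setT (fun p => (f p.1 * g p.2)%:E) /\
  (\int[mu \x mu]_p (f p.1 * g p.2)%:E =
    (\int[mu]_x (f x)%:E) * (\int[mu]_x (g x)%:E))%E.
Proof.
move=> hf hg.
have mf : measurable_fun setT f by apply/measurable_EFinP; exact: measurable_int hf.
have mg : measurable_fun setT g by apply/measurable_EFinP; exact: measurable_int hg.
have mfg : measurable_fun setT (fun p : R * R => (f p.1 * g p.2)%:E).
  apply/measurable_EFinP/measurable_funM.
    by apply: measurableT_comp.
  by apply: measurableT_comp.
have hfg : (mu \x mu)%E.-integrable setT (fun p => (f p.1 * g p.2)%:E).
  apply/integrable12ltyP => //=.
  have -> : (\int[mu]_x \int[mu]_y `|(f x * g y)%R|%:E =
      \int[mu]_x (`|f x|%:E * \int[mu]_y `|g y|%:E))%E.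
    apply: eq_integral => x _; under eq_integral do rewrite normrM EFinM.
    rewrite ge0_integralZl//.
    by apply/measurable_EFinP; exact: measurableT_comp.
  have [_ Ig] := integrableP _ _ _ hg; have [_ If] := integrableP _ _ _ hf.
  have [c Ec] : exists c : R, (\int[mu]_y `|g y|%:E)%E = c%:E.
    exists (fine (\int[mu]_y `|g y|%:E)%E); rewrite fineK// ge0_fin_numE//.
    exact: integral_ge0.
  have c0 : 0 <= c.
    by rewrite -lee_fin -Ec; exact: integral_ge0.
  rewrite Ec ge0_integralZr//; last by apply/measurable_EFinP; exact: measurableT_comp.
  apply: lte_mul_pinfty; [exact: integral_ge0| |exact: ltry].
  by rewrite ge0_fin_numE//; exact: integral_ge0.
split => //.
rewrite -integral12_prod_meas1// /fubini_F.
under eq_integral => x _.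
  under eq_integral do rewrite /= EFinM.
  rewrite integralZl//; over.
have := integrable_fin_num measurableT hg.
move=> /fineK <-; rewrite integralZr//.
Qed.

(** The product of Lebesgue measures is a measure on the square of
[measurableTypeR R], a synonym of [R] with its own measurable structure. Pushing
it forward along this identity makes a measure of [plane_measure], which is a
bare set function on [R * R]. *)
Definition plane_id (p : measurableTypeR R * measurableTypeR R) : R * R := p.

Lemma measurable_plane_id : measurable_fun setT plane_id.
Proof.
have h : measurable_fun setT (idfun : measurableTypeR R -> R).
  by move=> _ A mA; rewrite setTI; exact: mA.
have -> : plane_id = (fun p => ((p.1 : R), (p.2 : R))) by apply/funext; case.
apply/measurable_fun_pair.
  exact: (measurableT_comp h measurable_fst).
exact: (measurableT_comp h measurable_snd).
Qed.

Let pm : {measure set (R * R) -> \bar R} :=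
  @measure_function_pushforward__canonical__measure_function_Measure
    _ _ _ _ R (mu \x mu)%E plane_id measurable_plane_id.

Let plane_measure0 : @plane_measure R set0 = 0%E.
Proof. exact: (measure0 pm). Qed.

Let plane_measure_ge0 A : (0 <= @plane_measure R A)%E.
Proof. exact: (measure_ge0 pm). Qed.

Let plane_measure_additive : semi_sigma_additive (@plane_measure R).
Proof. exact: (@measure_semi_sigma_additive _ _ _ pm). Qed.

HB.instance Definition _ := isMeasure.Build _ _ _ (@plane_measure R)
  plane_measure0 plane_measure_ge0 plane_measure_additive.

Lemma plane_measureE : @plane_measure R = pushforward (mu \x mu)%E plane_id.
Proof. by []. Qed.

Lemma measurable_plane_compid d (U : measurableType d) (f : R * R -> U) :
  measurable_fun setT f -> measurable_fun setT (f \o plane_id).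
Proof. by move=> mf; apply: measurableT_comp => //; exact: measurable_plane_id. Qed.

Lemma integrable_plane (f : R * R -> \bar R) : measurable_fun setT f ->
  (mu \x mu)%E.-integrable setT f -> plane_measure.-integrable setT f.
Proof.
move=> mf hf; apply: (@integrable_pushforward _ _ _ _ _ plane_id measurable_plane_id (mu \x mu)%E) => //.
Qed.

Lemma integral_plane (f : R * R -> \bar R) : measurable_fun setT f ->
  (mu \x mu)%E.-integrable setT f ->
  (\int[plane_measure]_p f p = \int[mu \x mu]_p f p)%E.
Proof.
move=> mf hf; apply: (@integral_pushforward _ _ _ _ _ plane_id measurable_plane_id (mu \x mu)%E) => //.
Qed.

Lemma plane_integrable (f : R * R -> \bar R) : measurable_fun setT f ->
  plane_measure.-integrable setT f -> (mu \x mu)%E.-integrable setT f.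
Proof.
move=> mf /integrableP[_ hf]; apply/integrableP; split.
  exact: (measurable_plane_compid mf).
move: hf; rewrite plane_measureE (ge0_integral_pushforward measurable_plane_id)//.
exact: measurableT_comp.
Qed.

Lemma integrable_plane_prod (f g : R -> R) :
  mu.-integrable setT (EFin \o f) -> mu.-integrable setT (EFin \o g) ->
  plane_measure.-integrable setT (fun p => (f p.1 * g p.2)%:E) /\
  (\int[plane_measure]_p (f p.1 * g p.2)%:E =
    (\int[mu]_x (f x)%:E) * (\int[mu]_x (g x)%:E))%E.
Proof.
move=> hf hg; have [h <-] := integrable_prod_fun hf hg.
have mf : measurable_fun setT f by apply/measurable_EFinP; exact: measurable_int hf.
have mg : measurable_fun setT g by apply/measurable_EFinP; exact: measurable_int hg.
have m : measurable_fun setT (fun p : R * R => (f p.1 * g p.2)%:E).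
  apply/measurable_EFinP/measurable_funM.
    by apply: (@measurableT_comp _ _ _ _ _ _ f).
  by apply: (@measurableT_comp _ _ _ _ _ _ g).
by split; [exact: integrable_plane|exact: integral_plane].
Qed.

Lemma cintegral_prod_fun (f g : R -> C) :
  cintegrable mu setT f -> cintegrable mu setT g ->
  cintegrable plane_measure setT (fun p => f p.1 * g p.2) /\
  cintegral plane_measure setT (fun p => f p.1 * g p.2) =
    cintegral mu setT f * cintegral mu setT g.
Proof.
move=> [fr fi] [gr gi].
have [irr err] := integrable_plane_prod fr gr.
have [iri eri] := integrable_plane_prod fr gi.
have [iir eir] := integrable_plane_prod fi gr.
have [iii eii] := integrable_plane_prod fi gi.
have Frr := integrable_fin_num measurableT fr.
have Fri := integrable_fin_num measurableT fi.
have Gr := integrable_fin_num measurableT gr.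
have Gi := integrable_fin_num measurableT gi.
split.
  split.
    under eq_fun do rewrite cReM EFinB.
    exact: integrableB.
  under eq_fun do rewrite cImM EFinD.
  exact: integrableD.
apply: eq_cpx; rewrite ?cReM ?cImM /cintegral/=.
  under eq_integral do rewrite cReM EFinB.
  by rewrite integralB// err eii fineB ?fin_numM// !fineM.
under eq_integral do rewrite cImM EFinD.
by rewrite integralD// eri eir fineD ?fin_numM// !fineM.
Qed.

End ComplexFubini.

(** * Green's formula on the unit disc *)

Section DiscGreen.
Context {R : realType}.
Local Notation C := R[i].
Local Notation mu := (@lebesgue_measure R).

Lemma plane_discE (p : R * R) : plane_disc p <-> p.1 ^+ 2 + p.2 ^+ 2 < 1.
Proof.
rewrite /plane_disc/disc/= normc_lt1.
have -> : p.1 ^+ 2 + p.2 ^+ 2 = normc (p.1 +i* p.2) ^+ 2 by rewrite normcE2.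
by rewrite expr_lt1// normc_ge0.
Qed.

Lemma measurable_plane_disc : measurable (@plane_disc R).
Proof.
have -> : @plane_disc R = (fun p => p.1 ^+ 2 + p.2 ^+ 2) @^-1` `]-oo, 1[.
  by apply/seteqP; split => p /=; rewrite in_itv/= => /plane_discE.
rewrite -[X in measurable X]setTI.
have h : measurable_fun setT (fun p : R * R => p.1 ^+ 2 + p.2 ^+ 2).
  apply: measurable_funD; apply: measurable_funX.
    exact: measurable_fst.
  exact: measurable_snd.
by apply: h => //; exact: measurable_itv.
Qed.
Hint Resolve measurable_plane_disc : core.

Let norm_le_sqr (x r : R) : 0 <= r -> (`|x| <= r) = (x ^+ 2 <= r ^+ 2).
Proof. by move=> r0; rewrite -(real_normK (num_real x)) ler_pXn2r ?nnegrE. Qed.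

Let norm_lt_sqr (x r : R) : 0 <= r -> (`|x| < r) = (x ^+ 2 < r ^+ 2).
Proof. by move=> r0; rewrite -(real_normK (num_real x)) ltr_pXn2r ?nnegrE. Qed.

Lemma plane_measure_square (a b : R) : a <= b ->
  plane_measure (`[a, b] `*` `[a, b]) = ((b - a) * (b - a))%:E.
Proof.
move=> ab.
have -> : plane_measure (`[a, b] `*` `[a, b]) = (mu \x mu)%E (`[a, b] `*` `[a, b]) by [].
rewrite product_measure1E; [|exact: measurable_itv..].
transitivity ((b - a)%:E * (b - a)%:E)%E; last by rewrite -EFinM.
suff E : (mu `[a, b] = (b - a)%:E)%E by congr (_ * _)%E.
rewrite lebesgue_measure_itv/= lte_fin.
by move: ab; rewrite le_eqVlt => /orP[/eqP ->|->]; rewrite ?ltxx ?subrr// -EFinB.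
Qed.

Lemma plane_measure_disc_lty : (plane_measure (@plane_disc R) < +oo)%E.
Proof.
apply: (@le_lt_trans _ _ (plane_measure (`[-1, 1] `*` `[-1, 1] : set (R * R)))).
  apply: le_measure; rewrite ?inE//.
    by apply: measurableX; exact: measurable_itv.
  move=> [x y] /plane_discE /= h; split => /=; rewrite in_itv/= -ler_norml.
    by rewrite norm_le_sqr// expr1n; have := sqr_ge0 y; lra.
  rewrite norm_le_sqr// expr1n.
  by have := sqr_ge0 x; lra.
rewrite plane_measure_square ?ltry//; lra.
Qed.

(** The fundamental theorem of calculus on a chord of the disc, whose end points lie
on the circle, where [f] vanishes; for [|y| >= 1] the chord is empty. *)
Lemma integral_chord (f g : R -> R) (y : R) : measurable_fun setT g ->
  (forall x, x ^+ 2 + y ^+ 2 <= 1 -> is_derive x 1 f (g x)) ->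
  (forall x, x ^+ 2 + y ^+ 2 <= 1 -> {for x, continuous g}) ->
  (forall x, x ^+ 2 + y ^+ 2 = 1 -> f x = 0) ->
  (\int[mu]_(x in [set x | (x ^+ 2 + y ^+ 2 < 1)%R]) (g x)%:E = 0)%E.
Proof.
move=> mg fg cg f0.
have [y1|y1] := ltP (y ^+ 2) 1; last first.
  have -> : [set x | x ^+ 2 + y ^+ 2 < 1] = set0.
    apply/seteqP; split => x //= h; have := sqr_ge0 x; lra.
  by rewrite integral_set0.
pose rho : R := Num.sqrt (1 - y ^+ 2).
have rho2 : rho ^+ 2 = 1 - y ^+ 2 by rewrite sqr_sqrtr//; lra.
have rho0 : 0 < rho by rewrite sqrtr_gt0; lra.
have rhoE (x : R) : (`|x| <= rho) = (x ^+ 2 + y ^+ 2 <= 1).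
  by rewrite (norm_le_sqr _ (ltW rho0)) rho2; apply/idP/idP; lra.
have -> : [set x | x ^+ 2 + y ^+ 2 < 1] = `]- rho, rho[%classic.
  apply/seteqP; split => x /=; rewrite in_itv/= -ltr_norml.
    by move=> h; rewrite (norm_lt_sqr _ (ltW rho0)) rho2; lra.
  by rewrite (norm_lt_sqr _ (ltW rho0)) rho2; lra.
rewrite -(@integral_itv_bndoo _ _ _ _ true false); last first.
  by apply/measurable_EFinP; exact: measurable_funTS.
have dd (x : R) : `|x| <= rho -> is_derive x 1 f (g x) by rewrite rhoE; exact: fg.
have df (x : R) : `|x| <= rho -> {for x, continuous f}.
  by move=> /dd [h _]; apply/differentiable_continuous/derivable1_diffP.
have rr : `|rho| <= rho by rewrite ger0_norm// ltW.
have rN : `|- rho| <= rho by rewrite normrN.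
have z0 : f rho = 0 by apply: f0; rewrite rho2; lra.
have zN : f (- rho) = 0 by apply: f0; rewrite sqrrN rho2; lra.
rewrite (@continuous_FTC2 _ g f)//.
- by rewrite z0 zN subee.
- by rewrite ltrNl; lra.
- apply: continuous_in_subspaceT => x /set_mem /=; rewrite in_itv/= -ler_norml => h.
  by apply: cg; rewrite -rhoE.
- split.
  + move=> x; rewrite in_itv/= -ltr_norml => /ltW /dd [h _]; exact: h.
  + apply: cvg_at_right_filter; exact: df.
  + apply: cvg_at_left_filter; exact: df.
- move=> x; rewrite in_itv/= -ltr_norml => /ltW /dd [_ h].
  by rewrite derive1E.
Qed.

Let bounded_integrable (g : R * R -> R) : measurable_fun setT g ->
  (exists K, forall p, plane_disc p -> `|g p| <= K) ->
  plane_measure.-integrable plane_disc (EFin \o g).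
Proof.
move=> mg [K gK]; apply: measurable_bounded_integrable => //.
- exact: plane_measure_disc_lty.
- exact: measurable_funTS.
- exists K; split; first exact: num_real.
  by move=> M KM p Dp /=; exact: le_trans (gK p Dp) (ltW KM).
Qed.

Let integral_disc_setT (g : R * R -> R) : measurable_fun setT g ->
  (exists K, forall p, plane_disc p -> `|g p| <= K) ->
  let h := (EFin \o g) \_ plane_disc in
  (mu \x mu)%E.-integrable setT h /\
  (\int[plane_measure]_(p in plane_disc) (g p)%:E = \int[mu \x mu]_p h p)%E.
Proof.
move=> mg gK h.
have mh : measurable_fun setT h.
  by apply/(measurable_restrictT (EFin \o g) measurable_plane_disc); apply/measurable_EFinP; exact: measurable_funTS.
have ih : plane_measure.-integrable setT h.
  exact: (integrable_mkcond (EFin \o g) measurable_plane_disc).1 (bounded_integrable mg gK).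
have ih' := plane_integrable mh ih.
by split=> //; rewrite integral_mkcond integral_plane.
Qed.

(** Green's formula for a single partial derivative: by Fubini the integral over the
disc is computed chord by chord. *)
Lemma integral_disc_dx (f g : R * R -> R) : measurable_fun setT g ->
  (exists K, forall p, plane_disc p -> `|g p| <= K) ->
  (forall x y : R, x ^+ 2 + y ^+ 2 <= 1 -> is_derive x 1 (fun s : R => f (s, y)) (g (x, y))) ->
  (forall x y : R, x ^+ 2 + y ^+ 2 <= 1 -> {for x, continuous (fun s : R => g (s, y))}) ->
  (forall x y : R, x ^+ 2 + y ^+ 2 = 1 -> f (x, y) = 0) ->
  (\int[plane_measure]_(p in plane_disc) (g p)%:E = 0)%E.
Proof.
move=> mg gK fg cg f0; have [ih ->] := integral_disc_setT mg gK.
rewrite -(integral21_prod_meas1 ih) /fubini_G; apply: integral0_eq => y _.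
rewrite -[RHS](@integral_chord (fun x => f (x, y)) (fun x => g (x, y)) y) //.
- rewrite [in RHS]integral_mkcond; apply: eq_integral => x _.
  rewrite /patch; congr (if _ then _ else _).
  by apply/idP/idP => /set_mem H; apply/mem_set;
    [exact: (plane_discE (x, y)).1|exact: (plane_discE (x, y)).2].
- apply: measurableT_comp => //; exact: measurable_pair2.
- by move=> x; exact: cg.
- by move=> x; exact: f0.
Qed.

Lemma integral_disc_dy (f g : R * R -> R) : measurable_fun setT g ->
  (exists K, forall p, plane_disc p -> `|g p| <= K) ->
  (forall x y : R, x ^+ 2 + y ^+ 2 <= 1 -> is_derive y 1 (fun s : R => f (x, s)) (g (x, y))) ->
  (forall x y : R, x ^+ 2 + y ^+ 2 <= 1 -> {for y, continuous (fun s : R => g (x, s))}) ->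
  (forall x y : R, x ^+ 2 + y ^+ 2 = 1 -> f (x, y) = 0) ->
  (\int[plane_measure]_(p in plane_disc) (g p)%:E = 0)%E.
Proof.
move=> mg gK fg cg f0; have [ih ->] := integral_disc_setT mg gK.
rewrite -(integral12_prod_meas1 ih) /fubini_F; apply: integral0_eq => x _.
rewrite -[RHS](@integral_chord (fun y => f (x, y)) (fun y => g (x, y)) x) //.
- rewrite [in RHS]integral_mkcond; apply: eq_integral => y _.
  rewrite /patch; congr (if _ then _ else _).
  apply/idP/idP => /set_mem H; apply/mem_set.
    by rewrite /= addrC; exact: (plane_discE (x, y)).1.
  by apply: (plane_discE (x, y)).2; rewrite addrC.
- apply: measurableT_comp => //; exact: measurable_pair1.
- by move=> y; rewrite addrC; exact: fg.
- by move=> y; rewrite addrC; exact: cg.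
- by move=> y; rewrite addrC; exact: f0.
Qed.

End DiscGreen.

Section DiscRegular.
Context {R : realType}.
Local Notation C := R[i].
Implicit Types f g : C -> C.

(** A class of functions wide enough to contain the kernels below together with their
partial derivatives, being closed under ring operations, conjugation and, away
from zeros, inversion. Boundedness gives integrability over the disc, and
differentiability along the axes gives the continuity along chords that the
fundamental theorem of calculus asks of a derivative. *)
Definition disc_regular f : Prop :=
  [/\ measurable_cfun (fun p : R * R => f (p.1 +i* p.2)),
      (exists K : R, forall z, normc z <= 1 -> normc (f z) <= K),
      (forall x y : R, normc (x +i* y) <= 1 ->
        exists l, is_cderive (fun s : R => f (s +i* y)) x l) &
      (forall x y : R, normc (x +i* y) <= 1 ->
        exists l, is_cderive (fun s : R => f (x +i* s)) y l)].

Lemma is_cderive_re (x y : R) : is_cderive (fun s : R => s +i* y) x 1.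
Proof. by split => /=; [exact: is_derive_id|exact: is_derive_cst]. Qed.

Lemma is_cderive_im (x y : R) : is_cderive (fun s : R => x +i* s) y 'i%C.
Proof. by split => /=; [exact: is_derive_cst|exact: is_derive_id]. Qed.

Lemma disc_regular_cst (a : C) : disc_regular (fun=> a).
Proof.
split; [exact: measurable_cfun_cst|by exists (normc a)| |] => x y _;
  exists 0; exact: is_cderive_cst.
Qed.

Lemma disc_regular_id : disc_regular id.
Proof.
split.
- by split => /=; [exact: measurable_fst|exact: measurable_snd].
- by exists 1.
- by move=> x y _; exists 1; exact: is_cderive_re.
- by move=> x y _; exists 'i%C; exact: is_cderive_im.
Qed.

Lemma disc_regularD f g : disc_regular f -> disc_regular g ->
  disc_regular (fun z => f z + g z).
Proof.
move=> [mf [K bf] fx fy] [mg [L bg] gx gy]; split.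
- exact: measurable_cfunD.
- exists (K + L) => z z1; apply: le_trans (normc_leD _ _) _.
  by rewrite lerD ?bf ?bg.
- move=> x y h; have [l hl] := fx x y h; have [m hm] := gx x y h.
  by exists (l + m); exact: is_cderiveD.
- move=> x y h; have [l hl] := fy x y h; have [m hm] := gy x y h.
  by exists (l + m); exact: is_cderiveD.
Qed.

Lemma disc_regularM f g : disc_regular f -> disc_regular g ->
  disc_regular (fun z => f z * g z).
Proof.
move=> [mf [K bf] fx fy] [mg [L bg] gx gy]; split.
- exact: measurable_cfunM.
- exists (K * L) => z z1; rewrite Normc.normcM.
  by rewrite ler_pM ?normc_ge0 ?bf ?bg.
- move=> x y h; have [l hl] := fx x y h; have [m hm] := gx x y h.
  by eexists; exact: (is_cderiveM hl hm).
- move=> x y h; have [l hl] := fy x y h; have [m hm] := gy x y h.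
  by eexists; exact: (is_cderiveM hl hm).
Qed.

Lemma disc_regularN f : disc_regular f -> disc_regular (fun z => - f z).
Proof.
move=> hf; have := disc_regularM (disc_regular_cst (-1)) hf.
by congr disc_regular; apply/funext => z; rewrite mulN1r.
Qed.

Lemma disc_regularB f g : disc_regular f -> disc_regular g ->
  disc_regular (fun z => f z - g z).
Proof. by move=> hf hg; apply: disc_regularD => //; exact: disc_regularN. Qed.

Lemma disc_regularX f n : disc_regular f -> disc_regular (fun z => f z ^+ n).
Proof.
move=> hf; elim: n => [|n IH]; first exact: (disc_regular_cst 1).
have -> : (fun z => f z ^+ n.+1) = (fun z => f z * f z ^+ n).
  by apply/funext => z; rewrite exprS.
exact: disc_regularM.
Qed.

Lemma disc_regularJ f : disc_regular f -> disc_regular (fun z => (f z)^*).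
Proof.
move=> [mf [K bf] fx fy]; split.
- exact: measurable_cfunJ.
- by exists K => z z1; rewrite normc_conj bf.
- by move=> x y /fx [l hl]; exists l^*; exact: is_cderiveJ.
- by move=> x y /fy [l hl]; exists l^*; exact: is_cderiveJ.
Qed.

Lemma disc_regularV f (e : R) : 0 < e ->
  (forall z, normc z <= 1 -> e <= normc (f z)) ->
  disc_regular f -> disc_regular (fun z => (f z)^-1).
Proof.
move=> e0 ef [mf [K bf] fx fy].
have f0 z : normc z <= 1 -> f z != 0.
  by move=> /ef h; rewrite -normc_gt0; exact: lt_le_trans h.
split.
- exact: measurable_cfunV.
- exists e^-1 => z z1; rewrite Normc.normcV lef_pV2 ?posrE ?ef//.
  by rewrite normc_gt0 f0.
- move=> x y h; have [l hl] := fx x y h.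
  by eexists; apply: is_cderiveV hl; exact: f0.
- move=> x y h; have [l hl] := fy x y h.
  by eexists; apply: is_cderiveV hl; exact: f0.
Qed.

Lemma plane_disc_normc (p : R * R) : plane_disc p -> normc (p.1 +i* p.2) < 1.
Proof. by rewrite /plane_disc/disc/= normc_lt1. Qed.

Lemma disc_regular_integrable f : disc_regular f ->
  cintegrable plane_measure plane_disc (fun p => f (p.1 +i* p.2)).
Proof.
move=> [mf [K bf] _ _].
apply: (@cintegrable_le _ _ _ plane_measure _ _ _ (cst K)) => //.
- exact: measurable_plane_disc.
- apply: measurable_bounded_integrable => //.
  + exact: measurable_plane_disc.
  + exact: plane_measure_disc_lty.
  + exists `|K|; split; first exact: num_real.
    by move=> M KM p _ /=; exact: ltW.
- by move=> p /plane_disc_normc/ltW; exact: bf.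
Qed.

Lemma disc_circle (x y : R) : (normc (x +i* y) <= 1) = (x ^+ 2 + y ^+ 2 <= 1).
Proof.
rewrite -(@ler_pXn2r _ 2)// ?nnegrE ?normc_ge0// expr1n.
by rewrite normcE2.
Qed.

(** Green's formula for the Cauchy-Riemann operator [d/dx + i d/dy], with a boundary
term that vanishes along with [f] on the circle. *)
Lemma disc_green f gx gy : disc_regular gx -> disc_regular gy ->
  (forall x y : R, normc (x +i* y) <= 1 ->
    is_cderive (fun s : R => f (s +i* y)) x (gx (x +i* y))) ->
  (forall x y : R, normc (x +i* y) <= 1 ->
    is_cderive (fun s : R => f (x +i* s)) y (gy (x +i* y))) ->
  (forall z, normc z = 1 -> f z = 0) ->
  cintegral plane_measure plane_disc
    (fun p => gx (p.1 +i* p.2) + 'i%C * gy (p.1 +i* p.2)) = 0.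
Proof.
move=> rx ry fx fy f0.
have circ (x y : R) : x ^+ 2 + y ^+ 2 = 1 -> f (x +i* y) = 0.
  move=> h; apply: f0; apply/eqP.
  by rewrite -(@eqrXn2 _ 2)// ?normc_ge0// normcE2/= h expr1n.
have cont (h : R -> R) (x l : R) : is_derive x 1 h l -> {for x, continuous h}.
  by move=> [H _]; apply/differentiable_continuous/derivable1_diffP.
rewrite (cintegralD (mu := plane_measure)); last 3 first.
- exact: measurable_plane_disc.
- exact: disc_regular_integrable.
- apply: (cintegrableZl (mu := plane_measure)) => //; first exact: measurable_plane_disc.
  exact: disc_regular_integrable.
rewrite (cintegralZl (mu := plane_measure)); last 2 first.
- exact: measurable_plane_disc.
- exact: disc_regular_integrable.
have -> : cintegral plane_measure plane_disc (fun p => gx (p.1 +i* p.2)) = 0.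
  case: rx => -[mr mi] [K bK] dx dy.
  apply: cintegral_eq0.
    apply: (@integral_disc_dx _ (fun p => Re (f (p.1 +i* p.2)))) => //=.
    - exists K => p /plane_disc_normc/ltW/bK; apply: le_trans; exact: Re_le_normc.
    - by move=> x y; rewrite -disc_circle => /fx [].
    - move=> x y; rewrite -disc_circle => /dx [l [h _]]; exact: cont h.
    - by move=> x y /circ ->.
  apply: (@integral_disc_dx _ (fun p => Im (f (p.1 +i* p.2)))) => //=.
  - exists K => p /plane_disc_normc/ltW/bK; apply: le_trans; exact: Im_le_normc.
  - by move=> x y; rewrite -disc_circle => /fx [].
  - move=> x y; rewrite -disc_circle => /dx [l [_ h]]; exact: cont h.
  - by move=> x y /circ ->.
have -> : cintegral plane_measure plane_disc (fun p => gy (p.1 +i* p.2)) = 0.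
  case: ry => -[mr mi] [K bK] dx dy.
  apply: cintegral_eq0.
    apply: (@integral_disc_dy _ (fun p => Re (f (p.1 +i* p.2)))) => //=.
    - exists K => p /plane_disc_normc/ltW/bK; apply: le_trans; exact: Re_le_normc.
    - by move=> x y; rewrite -disc_circle => /fy [].
    - move=> x y; rewrite -disc_circle => /dy [l [h _]]; exact: cont h.
    - by move=> x y /circ ->.
  apply: (@integral_disc_dy _ (fun p => Im (f (p.1 +i* p.2)))) => //=.
  - exists K => p /plane_disc_normc/ltW/bK; apply: le_trans; exact: Im_le_normc.
  - by move=> x y; rewrite -disc_circle => /fy [].
  - move=> x y; rewrite -disc_circle => /dy [l [_ h]]; exact: cont h.
  - by move=> x y /circ ->.
by rewrite mulr0 addr0.
Qed.

End DiscRegular.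

(** * The reproducing integral on the disc *)

Section BergmanKernel.
Context {R : realType}.
Local Notation C := R[i].
Local Notation I f := (cintegral plane_measure plane_disc
  (fun p : R * R => f (p.1 +i* p.2))).

Lemma disc_regular_weight : disc_regular (fun z : C => 1 - z * z^*).
Proof.
apply: disc_regularB; first exact: disc_regular_cst.
by apply: disc_regularM; [|apply: disc_regularJ]; exact: disc_regular_id.
Qed.

Lemma affine_ge (A B : C) (z : C) : normc z <= 1 -> normc A - normc B <= normc (A - B * z).
Proof.
move=> z1; apply: le_trans (normc_geB _ _); rewrite lerD2l lerN2 Normc.normcM.
by rewrite ler_piMr// normc_ge0.
Qed.

Lemma affine_neq0 (A B : C) (z : C) : normc B < normc A -> normc z <= 1 -> A - B * z != 0.
Proof.
move=> AB z1; rewrite -normc_gt0; apply: lt_le_trans (affine_ge A B z1).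
by rewrite subr_gt0.
Qed.

Lemma disc_regular_affineV (A B : C) : normc B < normc A ->
  disc_regular (fun z => (A - B * z)^-1).
Proof.
move=> AB; apply: (@disc_regularV _ _ (normc A - normc B)).
- by rewrite subr_gt0.
- by move=> z; exact: affine_ge.
- apply: disc_regularB; first exact: disc_regular_cst.
  by apply: disc_regularM; [exact: disc_regular_cst|exact: disc_regular_id].
Qed.

Lemma disc_regular_affineVJ (w : C) : normc w < 1 ->
  disc_regular (fun z => (1 - w * z^*)^-1).
Proof.
move=> w1; have h : normc w^* < normc (1 : C) by rewrite normc_conj Normc.normc1.
have := disc_regularJ (disc_regular_affineV h).
congr disc_regular; apply/funext => z.
by rewrite fmorphV rmorphB rmorphM rmorph1 /= conjCK.
Qed.

Section DbarVanish.
Variables (N : nat) (w A B : C).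
Hypotheses (w1 : normc w < 1) (AB : normc B < normc A).
Let P (z : C) : C := 1 - z * z^*.
Let V (z : C) : C := (1 - w * z^*)^-1.
Let X (z : C) : C := (A - B * z)^-1.

Let Wn0 z : normc z <= 1 -> 1 - w * z^* != 0.
Proof.
move=> z1; apply: (@affine_neq0 1 w z^*); rewrite ?Normc.normc1//.
by rewrite normc_conj.
Qed.

(* The derivative of [P ^+ N.+1 * V ^+ N.+1 * X ^+ m] along a curve of velocity [d]. *)
Let G (m : nat) (d z : C) : C :=
  (N.+1%:R * P z ^+ N * - (d * z^* + z * d^*)) * V z ^+ N.+1 * X z ^+ m +
  P z ^+ N.+1 * (N.+1%:R * V z ^+ N * (w * d^* * V z ^+ 2)) * X z ^+ m +
  P z ^+ N.+1 * V z ^+ N.+1 * (m%:R * X z ^+ m.-1 * (B * d * X z ^+ 2)).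

Let regP : disc_regular P. Proof. exact: disc_regular_weight. Qed.
Let regV : disc_regular V. Proof. exact: disc_regular_affineVJ. Qed.
Let regX : disc_regular X. Proof. exact: disc_regular_affineV. Qed.

Let regG m d : disc_regular (G m d).
Proof.
have c a := @disc_regular_cst R a.
have id := @disc_regular_id R.
have J := disc_regularJ id.
have PX k := disc_regularX k regP.
have VX k := disc_regularX k regV.
have XX k := disc_regularX k regX.
rewrite /G; apply: disc_regularD; [apply: disc_regularD|].
- apply: disc_regularM => //; apply: disc_regularM => //.
  apply: disc_regularM; first exact: disc_regularM.
  by apply: disc_regularN; apply: disc_regularD; exact: disc_regularM.
- apply: disc_regularM => //; apply: disc_regularM => //.
  apply: disc_regularM; first exact: disc_regularM.
  exact: disc_regularM.
- apply: disc_regularM; first exact: disc_regularM.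
  apply: disc_regularM; first exact: disc_regularM.
  exact: disc_regularM.
Qed.

Let derF m (z : R -> C) (t : R) (d : C) : normc (z t) <= 1 ->
  is_cderive z t d ->
  is_cderive (fun s => P (z s) ^+ N.+1 * V (z s) ^+ N.+1 * X (z s) ^+ m) t (G m d (z t)).
Proof.
move=> z1 dz.
have dP : is_cderive (fun s => P (z s)) t (- (d * (z t)^* + z t * d^*)).
  apply: (is_cderive_eq (is_cderiveB (is_cderive_cst 1 t) (is_cderiveM dz (is_cderiveJ dz)))).
  by rewrite sub0r.
have dV : is_cderive (fun s => V (z s)) t (w * d^* * V (z t) ^+ 2).
  have h := is_cderiveB (is_cderive_cst 1 t) (is_cderiveM (is_cderive_cst w t) (is_cderiveJ dz)).
  apply: (is_cderive_eq (is_cderiveV (Wn0 z1) h)).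
  by rewrite /V exprVn; ring.
have dX : is_cderive (fun s => X (z s)) t (B * d * X (z t) ^+ 2).
  have h := is_cderiveB (is_cderive_cst A t) (is_cderiveM (is_cderive_cst B t) dz).
  apply: (is_cderive_eq (is_cderiveV (affine_neq0 AB z1) h)).
  by rewrite /X exprVn; ring.
apply: (is_cderive_eq (is_cderiveM (is_cderiveM (is_cderiveX N.+1 dP)
  (is_cderiveX N.+1 dV)) (is_cderiveX m dX))).
by rewrite /G /=; ring.
Qed.

(* The terms of [G] that are linear in [d] cancel between [d = 1] and [d = i], as
   [1 + i * i = 0]; those linear in [d^*] add up. In particular the holomorphic
   factor [X ^+ m] is not differentiated. The remaining factor simplifies by
   [w * V * P - z = V * (w - z)]. *)
Let G_dbar m z : normc z <= 1 ->
  G m 1 z + 'i%C * G m 'i%C z =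
  (2 * N.+1%:R) * (P z ^+ N * V z ^+ N.+2 * X z ^+ m * (w - z)).
Proof.
move=> z1.
have VW : V z * (1 - w * z^*) = 1 by rewrite /V mulVf// Wn0.
have key (i : C) : i * i = -1 -> i^* = - i -> G m 1 z + i * G m i z =
   (2 * N.+1%:R) * (P z ^+ N * V z ^+ N.+1 * X z ^+ m * (w * V z * P z - z)).
  move=> ii iJ; rewrite /G iJ rmorph1 !exprS.
  transitivity ((1 + i * i) * (N.+1%:R * P z ^+ N * - z^* * (V z * V z ^+ N) * X z ^+ m)
    + (1 + i * i) * (P z * P z ^+ N * (V z * V z ^+ N) * (m%:R * X z ^+ m.-1 * (B * (X z * (X z * 1)))))
    + (1 - i * i) * (N.+1%:R * P z ^+ N * V z ^+ N * V z * X z ^+ m * (w * V z * P z - z))).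
    by ring.
  by rewrite ii; ring.
rewrite key; last 2 first.
- by rewrite -expr2 sqr_i.
- by apply: eq_cpx; rewrite /= ?oppr0.
congr (_ * _); rewrite [V z ^+ N.+2]exprS.
transitivity (P z ^+ N * V z ^+ N.+1 * X z ^+ m * (w * V z * P z - z * (V z * (1 - w * z^*)))).
  by rewrite VW mulr1.
by rewrite /P; ring.
Qed.

(** Up to the factor [2 * N.+1], the integrand is the Cauchy-Riemann derivative of
[P ^+ N.+1 * V ^+ N.+1 * X ^+ m], which vanishes on the circle because [P] does. *)
Lemma cintegral_dbar m :
  I (fun z => P z ^+ N * V z ^+ N.+2 * X z ^+ m * (w - z)) = 0.
Proof.
have nz : 2 * N.+1%:R != 0 :> C by rewrite mulf_neq0// pnatr_eq0.
apply: (mulfI nz); rewrite mulr0.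
rewrite -(cintegralZl (mu := plane_measure)); last 2 first.
- exact: measurable_plane_disc.
- apply: (@disc_regular_integrable _ (fun z => P z ^+ N * V z ^+ N.+2 * X z ^+ m * (w - z))).
  apply: disc_regularM.
    apply: disc_regularM; last exact: disc_regularX.
    by apply: disc_regularM; exact: disc_regularX.
  by apply: disc_regularB; [exact: disc_regular_cst|exact: disc_regular_id].
rewrite -[RHS](@disc_green R (fun z => P z ^+ N.+1 * V z ^+ N.+1 * X z ^+ m) (G m 1) (G m 'i%C)) //.
- apply: eq_cintegral => p /plane_disc_normc/ltW h.
  by rewrite G_dbar.
- by move=> x y h; apply: (@derF m (fun s => s +i* y) x 1) => //; exact: is_cderive_re.
- by move=> x y h; apply: (@derF m (fun s => x +i* s) y 'i%C) => //; exact: is_cderive_im.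
- by move=> z z1; rewrite /P mulcJ z1 expr1n subrr exprS !mul0r.
Qed.

(** Under the integral the holomorphic factor may be evaluated at [w]: since
[X z - X w = - (B * X w * X z * (w - z))], the difference of the two powers is a
combination of integrands killed by [cintegral_dbar]. *)
Lemma cintegral_kernel_shift :
  I (fun z => P z ^+ N * V z ^+ N.+2 * X z ^+ N.+2) =
  X w ^+ N.+2 * I (fun z => P z ^+ N * V z ^+ N.+2).
Proof.
have rPV : disc_regular (fun z => P z ^+ N * V z ^+ N.+2).
  by apply: disc_regularM; exact: disc_regularX.
have w1' := ltW w1.
pose c (i : 'I_N.+2) := - (B * X w ^+ i.+1).
pose T (i : 'I_N.+2) z := P z ^+ N * V z ^+ N.+2 * X z ^+ (N.+2 - i) * (w - z).
have rT i : disc_regular (T i).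
  apply: disc_regularM; first by apply: disc_regularM => //; exact: disc_regularX.
  by apply: disc_regularB; [exact: disc_regular_cst|exact: disc_regular_id].
have E z : normc z <= 1 -> P z ^+ N * V z ^+ N.+2 * X z ^+ N.+2 =
    X w ^+ N.+2 * (P z ^+ N * V z ^+ N.+2) + \sum_(i < N.+2) c i * T i z.
  move=> z1; apply/eqP; rewrite -subr_eq; apply/eqP.
  have -> : \sum_(i < N.+2) c i * T i z =
    (P z ^+ N * V z ^+ N.+2) * ((X z - X w) * \sum_(i < N.+2) X z ^+ (N.+2.-1 - i) * X w ^+ i).
    rewrite !mulr_sumr; apply: eq_bigr => i _.
    have -> : X z - X w = - (B * X w * X z * (w - z)).
      by rewrite /X; field; rewrite !affine_neq0.
    rewrite /c /T (_ : (N.+2 - i)%N = (N.+2.-1 - i).+1); last first.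
      by rewrite -subSn // -ltnS.
    by rewrite [X z ^+ _.+1]exprS [X w ^+ _.+1]exprS; ring.
  by rewrite -subrXX; ring.
transitivity (I (fun z => X w ^+ N.+2 * (P z ^+ N * V z ^+ N.+2) + \sum_(i < N.+2) c i * T i z)).
  by apply: eq_cintegral => p /plane_disc_normc/ltW h; rewrite E.
have mD := @measurable_plane_disc R.
rewrite (cintegralD (mu := plane_measure))//; last 2 first.
- by apply: (cintegrableZl (mu := plane_measure)) => //; exact: (disc_regular_integrable rPV).
- apply: (@cintegrable_sum _ _ _ plane_measure _ mD _ _ (fun i p => c i * T i (p.1 +i* p.2))) => i.
  by apply: (cintegrableZl (mu := plane_measure)) => //; exact: (disc_regular_integrable (rT i)).
rewrite (cintegralZl (mu := plane_measure))//; last exact: (disc_regular_integrable rPV).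
rewrite (@cintegral_sum _ _ _ plane_measure _ mD _ _ (fun i p => c i * T i (p.1 +i* p.2))); last first.
  by move=> i; apply: (cintegrableZl (mu := plane_measure)) => //; exact: (disc_regular_integrable (rT i)).
rewrite big1 ?addr0// => i _.
rewrite (cintegralZl (mu := plane_measure))//; last exact: (disc_regular_integrable (rT i)).
by rewrite cintegral_dbar mulr0.
Qed.

End DbarVanish.

Definition disc_mass N : C := I (fun z : C => (1 - z * z^*) ^+ N).

(** The integrand is at least [2 ^- N] on the square [-1/2, 1/2] x [-1/2, 1/2], which
lies in the disc. Positivity makes it possible to cancel this constant against
the normalisation of the coherent states. *)
Lemma disc_mass_gt0 N : 0 < Re (disc_mass N) /\ Im (disc_mass N) = 0.
Proof.
have PE (p : R * R) : 1 - (p.1 +i* p.2) * (p.1 +i* p.2)^* = (1 - (p.1 ^+ 2 + p.2 ^+ 2))%:C :> C.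
  by rewrite mulcJ normcE2 rmorphB rmorph1.
have mD := @measurable_plane_disc R.
have [hr hi] := disc_regular_integrable (disc_regularX N (@disc_regular_weight)).
split; last first.
  rewrite /disc_mass /cintegral/=.
  rewrite (_ : (\int[_]_(p in _) _ = 0)%E)//.
  by apply: integral0_eq => p _; rewrite PE -rmorphXn.
rewrite /disc_mass /cintegral/=; apply: fine_gt0.
rewrite (integrable_lty mD hr) andbT.
pose Q : set (R * R) := `[-1/2, 1/2] `*` `[-1/2, 1/2].
have mQ : measurable Q by apply: measurableX; exact: measurable_itv.
have QE p : Q p -> p.1 ^+ 2 + p.2 ^+ 2 <= 1/2.
  case=> /=; rewrite !in_itv/= => /andP[a b] /andP[c d]; nra.
have QD : Q `<=` @plane_disc R.
  by move=> p /QE h; apply/plane_discE; lra.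
apply: (@lt_le_trans _ _ (\int[plane_measure]_(p in Q) ((1/2) ^+ N)%:E)%E).
  rewrite integral_cst//= plane_measure_square; last lra.
  by rewrite -EFinM lte_fin mulr_gt0 ?exprn_gt0 ?mulr_gt0//; lra.
apply: (@le_trans _ _ (\int[plane_measure]_(p in Q)
    (Re ((1 - (p.1 +i* p.2) * (p.1 +i* p.2)^*) ^+ N))%:E)%E); last first.
  apply: ge0_subset_integral => //; first by case/integrableP: hr.
  move=> p /plane_discE h; rewrite PE -rmorphXn/= lee_fin exprn_ge0//; lra.
apply: ge0_le_integral => //.
- by case/integrableP: hr => h _; exact: (measurable_funS mD QD h).
- move=> p /QE h; rewrite PE -rmorphXn/= lee_fin; apply: lerXn2r; rewrite ?nnegrE; lra.
Qed.

Lemma disc_massJ N : (disc_mass N)^* = disc_mass N.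
Proof. by have [_ h] := disc_mass_gt0 N; apply: eq_cpx; rewrite ?cReJ ?cImJ ?h ?oppr0. Qed.

(** The reproducing property of the Bergman kernel, for powers of affine functions.
[cintegral_kernel_shift] is used twice: at [w] it takes out the holomorphic
factor, and at [0], after a conjugation that makes [(1 - w * z^* )^-1]
holomorphic, it replaces the latter by its value 1. *)
Lemma cintegral_kernel N (w A B : C) : normc w < 1 -> normc B < normc A ->
  I (fun z => (1 - z * z^*) ^+ N * (1 - w * z^*)^-1 ^+ N.+2 * (A - B * z)^-1 ^+ N.+2) =
  (A - B * w)^-1 ^+ N.+2 * disc_mass N.
Proof.
move=> w1 AB; rewrite cintegral_kernel_shift//; congr (_ * _).
have w1' : normc w^* < normc (1 : C) by rewrite normc_conj Normc.normc1.
have z0 : normc (0 : C) < 1 by rewrite Normc.normc0.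
have := @cintegral_kernel_shift N 0 1 w^* z0 w1'.
rewrite mulr0 subr0 invr1 expr1n mul1r => H.
apply: (inv_inj (@conjCK _)); rewrite disc_massJ.
rewrite -(cintegralJ (mu := plane_measure)); last 2 first.
- exact: measurable_plane_disc.
- apply: (@disc_regular_integrable _ (fun z => (1 - z * z^*) ^+ N * (1 - w * z^*)^-1 ^+ N.+2)).
  apply: disc_regularM; apply: disc_regularX; first exact: disc_regular_weight.
  exact: disc_regular_affineVJ.
rewrite /disc_mass.
transitivity (I (fun z => (1 - z * z^*) ^+ N * (1 - 0 * z^*)^-1 ^+ N.+2)); last first.
  by apply: eq_cintegral => p _; rewrite mul0r subr0 invr1 expr1n mulr1.
rewrite -H; apply: eq_cintegral => p _.
rewrite mul0r subr0 invr1 expr1n mulr1 rmorphM !rmorphXn/= fmorphV.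
by rewrite !rmorphB !rmorphM rmorph1 /= conjCK [_^* * _]mulrC.
Qed.

End BergmanKernel.

(** * The complex Gaussian integral *)

Section ImproperFTC.
Context {R : realType}.
Local Notation mu := (@lebesgue_measure R).

(** Dominated convergence applied to the fundamental theorem of calculus on [-n, n]. *)
Lemma integral_derive_line (F f : R -> R) : (forall x : R, is_derive x 1 F (f x)) ->
  continuous f -> mu.-integrable setT (EFin \o f) ->
  F n%:R @[n --> \oo] --> (0 : R) -> F (- n%:R) @[n --> \oo] --> (0 : R) ->
  (\int[mu]_x (f x)%:E = 0)%E.
Proof.
move=> dF cf fi F1 F2.
pose f_ n := (EFin \o f) \_ (`[- n%:R, n%:R]%classic : set R).
have mf : measurable_fun setT (EFin \o f) by exact: measurable_int fi.
have mitv n : measurable (`[- n%:R, n%:R]%classic : set R) by exact: measurable_itv.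
have mf_ n : measurable_fun setT (f_ n).
  by apply/(measurable_restrictT (EFin \o f) (mitv n)); exact: measurable_funTS.
have cvgf x : f_ ^~ x @ \oo --> (f x)%:E.
  apply: cvg_near_cst; exists (Num.bound `|x|) => // n /= hn.
  rewrite /f_ /patch mem_set//= in_itv/= -ler_norml.
  by apply: ltW; apply: lt_le_trans (archi_boundP (normr_ge0 x)) _; rewrite ler_nat.
have bf x n : (`|f_ n x| <= (abse \o (EFin \o f)) x)%E.
  by rewrite /f_ /patch /=; case: ifPn => // _; rewrite abse0 lee_fin.
have ae1 : {ae mu, forall x, setT x -> f_ ^~ x @ \oo --> (EFin \o f) x}.
  by apply: aeW => x _; exact: cvgf.
have ae2 : {ae mu, forall x n, setT x -> (`|f_ n x| <= (abse \o (EFin \o f)) x)%E}.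
  by apply: aeW => x n _; exact: bf.
have [_ _] := @dominated_convergence _ (measurableTypeR R) R mu setT measurableT f_ (EFin \o f)
  (abse \o (EFin \o f)) mf_ mf ae1 (integrable_abse fi) ae2.
have -> : [sequence (\int[mu]_x f_ n x)%E]_n = (fun n => (F n%:R - F (- n%:R))%:E).
  apply/funext => n /=; rewrite /f_ -integral_mkcond.
  case: n => [|n].
    by rewrite !oppr0 set_itv1 integral_set1 subrr.
  rewrite (@continuous_FTC2 _ f F)//.
  - by apply: (@lt_trans _ _ 0); rewrite ?oppr_lt0 ltr0n.
  - exact: continuous_subspaceT.
  - have cF : continuous F.
      by move=> x; apply/differentiable_continuous/derivable1_diffP; case: (dF x).
    split.
    + by move=> x _; case: (dF x).
    + by apply: cvg_at_right_filter; exact: cF.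
    + by apply: cvg_at_left_filter; exact: cF.
  - by move=> x _; case: (dF x) => _; rewrite derive1E.
move=> h; apply: (cvg_unique _ h) => //.
apply: cvg_EFin; first exact: nearW.
by rewrite -[X in _ --> X](subr0 0); apply: cvgB.
Qed.

(** The integrand is a positive multiple of the density of a normal distribution. *)
Lemma integral_gauss (g : R) : 0 < g ->
  mu.-integrable setT (fun x => (expR (- (x ^+ 2 / (2 * g))))%:E) /\
  0 < fine (\int[mu]_x (expR (- (x ^+ 2 / (2 * g))))%:E)%E.
Proof.
move=> g0; pose s := Num.sqrt g.
have s0 : s != 0 by rewrite gt_eqF// sqrtr_gt0.
have pE x : normal_pdf 0 s x = normal_peak s * expR (- (x ^+ 2 / (2 * g))).
  rewrite normal_pdfE// /normal_fun subr0 sqr_sqrtr ?ltW// mulNr.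
  by rewrite -(mulr_natl g 2).
have p0 := normal_peak_gt0 s0.
have iE x : (expR (- (x ^+ 2 / (2 * g))))%:E = ((normal_peak s)^-1%:E * (normal_pdf 0 s x)%:E)%E.
  by rewrite pE -EFinM mulKf// gt_eqF.
under eq_fun do rewrite iE; split.
  by apply: integrableZl => //; exact: integrable_normal_pdf.
rewrite integralZl//; last exact: integrable_normal_pdf.
by rewrite integral_normal_pdf mule1 /= invr_gt0.
Qed.

End ImproperFTC.

Section ComplexGaussian.
Context {R : realType}.
Local Notation C := R[i].
Local Notation mu := (@lebesgue_measure R).
Variables (g : R) (A : C).
Hypothesis g0 : 0 < g.

(* This is [exp (- (x - g * s * A) ^ 2 / (2 * g))], a Gaussian with a complex centre:
   letting [s] go from 0 to 1 moves the contour of integration. *)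
Let phi (s x : R) : C := cexp (s%:C * A * x%:C - (x ^+ 2 / (2 * g))%:C -
  (g * s ^+ 2 / 2)%:C * A ^+ 2).
Let a := normc A.
(* A bound for [phi] and its derivative in [s] on the open interval ]-1, 2[, which
   contains [0, 1]. The doubled variance absorbs the terms linear in [x], at the
   cost of the constant 13 = 4 + 9 found by completing the square in [expo]. *)
Let dom (x : R) : R := expR (13 * g * a ^+ 2) * expR (- (x ^+ 2 / (2 * (2 * g)))).

Let dom_ge0 x : 0 <= dom x.
Proof. by rewrite mulr_ge0 ?expR_ge0. Qed.

Let a0 : 0 <= a. Proof. exact: normc_ge0. Qed.

Let dom_int : mu.-integrable setT (EFin \o dom).
Proof.
rewrite /dom /comp; under eq_fun do rewrite EFinM; apply: integrableZl => //.
by have [] := @integral_gauss R (2 * g) (mulr_gt0 (ltr0Sn _ 1) g0).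
Qed.

Let expo (x : R) : 3 * a * `|x| + 4 * g * a ^+ 2 - x ^+ 2 / (2 * g) <=
  13 * g * a ^+ 2 - x ^+ 2 / (2 * (2 * g)).
Proof.
rewrite -[X in X / (2 * g)](real_normK (num_real x)) -[X in X / (2 * (2 * g))](real_normK (num_real x)).
set y := `|x|; have g0' : g != 0 by rewrite gt_eqF.
rewrite -subr_ge0.
have -> : 13 * g * a ^+ 2 - y ^+ 2 / (2 * (2 * g)) - (3 * a * y + 4 * g * a ^+ 2 - y ^+ 2 / (2 * g))
  = (y - 6 * g * a) ^+ 2 / (4 * g) by field.
by rewrite divr_ge0 ?sqr_ge0// mulr_ge0// ltW.
Qed.

Let phi_bound s x : -1 < s < 2 -> normc (phi s x) <=
  expR (2 * a * `|x| + 2 * g * a ^+ 2 - x ^+ 2 / (2 * g)).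
Proof.
move=> /andP[s1 s2]; have s2' : `|s| <= 2 by rewrite ler_norml; lra.
have ss : s ^+ 2 <= 4 by nra.
rewrite normc_cexp ler_expR !cReD !cReN.
have h1 : Re (s%:C * A * x%:C) <= 2 * a * `|x|.
  apply: le_trans (ler_norm _) _; apply: le_trans (Re_le_normc _) _.
  by rewrite !Normc.normcM !normc_real ler_wpM2r// ler_wpM2r.
have h2 : - Re ((g * s ^+ 2 / 2)%:C * A ^+ 2) <= 2 * g * a ^+ 2.
  rewrite -cReN; apply: le_trans (ler_norm _) _; apply: le_trans (Re_le_normc _) _.
  rewrite normc_opp Normc.normcM normc_real normcX -/a ger0_norm; last first.
    by rewrite divr_ge0// mulr_ge0 ?sqr_ge0// ltW.
  by rewrite ler_wpM2r ?sqr_ge0//; have := ler_wpM2l (ltW g0) ss; lra.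
rewrite [Re (x ^+ 2 / _)%:C]/=; lra.
Qed.

Let phi_dom s x : -1 < s < 2 -> normc (phi s x) <= dom x.
Proof.
move=> /(@phi_bound s x) h; apply: le_trans h _; rewrite /dom -expRD ler_expR.
have := expo x; have := mulr_ge0 a0 (normr_ge0 x).
by have := mulr_ge0 (ltW g0) (sqr_ge0 a); lra.
Qed.

Let dphi_dom s x : -1 < s < 2 ->
  normc ((A * x%:C - (g * s)%:C * A ^+ 2) * phi s x) <= dom x.
Proof.
move=> h; rewrite Normc.normcM.
have h1 : normc (A * x%:C - (g * s)%:C * A ^+ 2) <= expR (a * `|x| + 2 * g * a ^+ 2).
  apply: (@le_trans _ _ (a * `|x| + 2 * g * a ^+ 2)); last first.
    by apply: le_trans (expR_ge1Dx _); rewrite lerDr.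
  apply: le_trans (normc_leB _ _) _; rewrite !Normc.normcM !normc_real -/a -expr2 lerD2l.
  rewrite ler_wpM2r ?sqr_ge0// normrM gtr0_norm// mulrC; apply: ler_wpM2r; first exact: ltW.
  by move: h => /andP[s1 s2]; rewrite ler_norml; lra.
apply: le_trans (ler_pM (normc_ge0 _) (normc_ge0 _) h1 (phi_bound x h)) _.
rewrite /dom -!expRD ler_expR; have := expo x; lra.
Qed.

Let mphi s : measurable_cfun (phi s : measurableTypeR R -> C).
Proof.
apply: measurable_cfun_cexp; apply: measurable_cfunB; last exact: measurable_cfun_cst.
apply: measurable_cfunB.
  by apply: measurable_cfunM; [exact: measurable_cfun_cst|exact: measurable_cfun_real].
by apply: measurable_cfun_real; apply: measurable_funM.
Qed.

Let intphi s : -1 < s < 2 -> cintegrable mu setT (phi s).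
Proof.
move=> h; apply: (@cintegrable_le _ _ _ mu _ measurableT _ dom (mphi s) dom_int) => x _.
exact: phi_dom.
Qed.

Let derx s x : is_cderive (phi s) x ((s%:C * A - (x / g)%:C) * phi s x).
Proof.
apply: is_cderive_cexp.
have q : is_cderive (fun y : R => (y ^+ 2 / (2 * g))%:C) x (x / g)%:C.
  have -> : (fun y : R => (y ^+ 2 / (2 * g))%:C) = (fun y : R => y%:C ^+ 2 * ((2 * g)^-1)%:C).
    by apply/funext => y; rewrite rmorphM rmorphXn.
  apply: (is_cderive_eq (is_cderiveM (is_cderiveX 2 (is_cderive_id x)) (is_cderive_cst _ x))).
  rewrite mulr0 addr0 mulr1 expr1 -[2%:R](rmorph_nat (@real_complex_def R _)) -!rmorphM.
  by congr (_ %:C); field; rewrite gt_eqF.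
apply: (is_cderive_eq (is_cderiveB (is_cderiveB (is_cderiveM
  (is_cderive_cst (s%:C * A) x) (is_cderive_id x)) q) (is_cderive_cst _ x))).
by rewrite mul0r mulr1 add0r subr0.
Qed.

Let ders s x : is_cderive (phi ^~ x) s ((A * x%:C - (g * s)%:C * A ^+ 2) * phi s x).
Proof.
apply: (is_cderive_cexp (f := fun s : R => s%:C * A * x%:C - (x ^+ 2 / (2 * g))%:C -
  (g * s ^+ 2 / 2)%:C * A ^+ 2)).
have q : is_cderive (fun y : R => (g * y ^+ 2 / 2)%:C) s (g * s)%:C.
  have -> : (fun y : R => (g * y ^+ 2 / 2)%:C) = (fun y : R => (g / 2)%:C * y%:C ^+ 2).
    by apply/funext => y; rewrite -rmorphXn -rmorphM; congr (_ %:C); ring.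
  apply: (is_cderive_eq (is_cderiveM (is_cderive_cst _ s) (is_cderiveX 2 (is_cderive_id s)))).
  rewrite mul0r add0r mulr1 expr1 -[X in _ * (X * _)](rmorph_nat (@real_complex_def R _)) -!rmorphM.
  by congr (_ %:C); field.
apply: (is_cderive_eq (is_cderiveB (is_cderiveB 
  (is_cderiveM (is_cderiveM (is_cderive_id s) (is_cderive_cst A s)) (is_cderive_cst _ s))
  (is_cderive_cst _ s)) (is_cderiveM q (is_cderive_cst _ s)))).
by rewrite mul1r !mulr0 !addr0 subr0.
Qed.

Let dom_cvg0 (u : nat -> R) : (forall n, `|u n| = n%:R) ->
  dom (u n) @[n --> \oo] --> (0 : R).
Proof.
move=> un.
pose c := expR (13 * g * a ^+ 2) * (2 * (2 * g)).
have g2 : 0 < 2 * (2 * g) by rewrite !mulr_gt0.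
apply: (@squeeze_cvgr _ _ _ _ (cst 0) (fun n => c * n%:R^-1)).
- exists 1 => // n /= n1; apply/andP; split; first exact: dom_ge0.
  rewrite /dom /c /= -[leRHS]mulrA ler_wpM2l ?expR_ge0//.
  have n0 : 0 < n%:R :> R by rewrite ltr0n.
  have n1' : 1 <= n%:R :> R by rewrite ler1n.
  rewrite -(real_normK (num_real (u n))) un expRN -[leRHS]invrK.
  rewrite lef_pV2 ?posrE ?expR_gt0//; last by rewrite invr_gt0 mulr_gt0// invr_gt0.
  apply: le_trans (expR_ge1Dx _); rewrite invfM invrK mulrC.
  apply: (@le_trans _ _ (n%:R ^+ 2 / (2 * (2 * g)))); last by rewrite lerDr.
  by rewrite ler_pM2r ?invr_gt0// expr2 ler_peMr// ltW.
- exact: cvg_cst.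
- rewrite -[X in _ --> X](mulr0 c); apply: cvgM; first exact: cvg_cst.
  by rewrite -cvg_shiftS; exact: cvg_harmonic.
Qed.

(* The derivative of [phi] in [s] is [- g * A] times its derivative in [x], hence
   has integral zero. *)
Let dphi_integral0 (c : C) s : -1 < s < 2 ->
  (\int[mu]_x (Re (c * ((A * x%:C - (g * s)%:C * A ^+ 2) * phi s x)))%:E = 0)%E.
Proof.
move=> h.
have mf : measurable_cfun (fun x : measurableTypeR R => c * ((A * x%:C - (g * s)%:C * A ^+ 2) * phi s x)).
  apply: measurable_cfunM; first exact: measurable_cfun_cst.
  apply: measurable_cfunM => //; apply: measurable_cfunB; last exact: measurable_cfun_cst.
  by apply: measurable_cfunM; [exact: measurable_cfun_cst|exact: measurable_cfun_real].
have fi : cintegrable mu setT (fun x => c * ((A * x%:C - (g * s)%:C * A ^+ 2) * phi s x)).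
  apply: (@cintegrable_le _ _ _ mu _ measurableT _ (fun x => normc c * dom x)) => //.
    by rewrite /comp; under eq_fun do rewrite EFinM; exact: integrableZl.
  move=> x _; rewrite [normc (c * _)]Normc.normcM ler_wpM2l ?normc_ge0//; exact: dphi_dom.
pose F x := Re (c * ((- (g%:C * A)) * phi s x)).
have dF (x : R) : is_derive x 1 F (Re (c * ((A * x%:C - (g * s)%:C * A ^+ 2) * phi s x))).
  have := is_cderiveM (is_cderive_cst c x) (is_cderiveM (is_cderive_cst (- (g%:C * A)) x) (derx s x)).
  move=> -[H _]; apply: (is_derive_eq H); congr Re.
  have -> : (x / g)%:C = x%:C * (g%:C)^-1 :> C by rewrite rmorphM fmorphV.
  have gC : g%:C != 0 :> C by rewrite fmorph_eq0 gt_eqF.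
  by rewrite [(g * s)%:C]rmorphM; field.
have FD (u : nat -> R) : (forall n, `|u n| = n%:R) -> F (u n) @[n --> \oo] --> (0 : R).
  move=> un; apply: norm_cvg0.
  pose K := normc c * (g * a).
  apply: (@squeeze_cvgr _ _ _ _ (cst 0) (fun n => K * dom (u n))).
  - apply: nearW => n; rewrite normr_ge0 /=; apply: le_trans (Re_le_normc _) _.
    rewrite 2!Normc.normcM normc_opp Normc.normcM normc_real gtr0_norm// mulrA.
    by rewrite ler_wpM2l ?phi_dom// mulr_ge0 ?normc_ge0// mulr_ge0// ltW.
  - exact: cvg_cst.
  - by rewrite -[X in _ --> X](mulr0 K); apply: cvgM; [exact: cvg_cst|exact: dom_cvg0].
apply: (integral_derive_line dF).
- move=> x; apply/differentiable_continuous/derivable1_diffP.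
  have e : is_cderive (fun x : R => A * x%:C - (g * s)%:C * A ^+ 2) x (0 * x%:C + A * 1 - 0).
    by apply: is_cderiveB; [apply: is_cderiveM (is_cderive_id x)|]; exact: is_cderive_cst.
  have [[H _] _] := is_cderiveM (is_cderive_cst c x) (is_cderiveM e (derx s x)).
  exact: H.
- by case: fi.
- by apply: FD => n; rewrite ger0_norm.
- by apply: FD => n; rewrite normrN ger0_norm.
Qed.

(* Taking [c = 1] and [c = - 'i] gives the real and the imaginary part. *)
Let phi_integral (c : C) :
  (\int[mu]_(x in setT) Re (c * phi 1 x) = \int[mu]_(x in setT) Re (c * phi 0 x))%R.
Proof.
pose H (s : R) := (\int[mu]_(x in setT) Re (c * phi s x))%R.
have ders' (s x : R) : is_derive s 1 (fun s => Re (c * phi s x))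
    (Re (c * ((A * x%:C - (g * s)%:C * A ^+ 2) * phi s x))).
  have [h _] := is_cderiveM (is_cderive_cst c s) (ders s x).
  by apply: (is_derive_eq h); rewrite mul0r add0r.
have d1E s x : partial1of2 (fun s x => Re (c * phi s x)) s x = Re (c * ((A * x%:C - (g * s)%:C * A ^+ 2) * phi s x)).
  by rewrite /partial1of2 derive1E; case: (ders' s x).
have dH (s : R) : -1 < s < 2 -> is_derive s 1 H 0.
  move=> hs.
  have Is : `](-1), 2[%classic s by rewrite /= in_itv.
  have h1 : forall x, `](-1 : R), 2[%classic x -> mu.-integrable setT (EFin \o (fun y => Re (c * phi x y))).
    move=> x; rewrite /= in_itv/= => hx.
    by have [] := cintegrableZl measurableT c (intphi hx).
  have h2 : forall x y, `](-1 : R), 2[%classic x -> [set: R] y -> derivable ((fun x y => Re (c * phi x y)) ^~ y) x 1.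
    by move=> x y _ _; case: (ders' x y).
  have h3 : forall y, 0 <= normc c * dom y by move=> y; rewrite mulr_ge0 ?normc_ge0.
  have h4 : mu.-integrable setT (EFin \o (fun y => normc c * dom y)).
    by rewrite /comp; under eq_fun do rewrite EFinM; exact: integrableZl.
  have h5 : forall x y, `](-1 : R), 2[%classic x -> [set: R] y ->
     `|partial1of2 (fun s x => Re (c * phi s x)) x y| <= normc c * dom y.
    move=> x y; rewrite /= in_itv/= => hx _; rewrite d1E.
    apply: le_trans (Re_le_normc _) _; rewrite [normc (c * _)]Normc.normcM ler_wpM2l ?normc_ge0//.
    exact: dphi_dom.
  have e1 := derivable_under_integral measurableT Is h1 h2 h3 h4 h5.
  have e2 := differentiation_under_integral measurableT Is h1 h2 h3 h4 h5.
  apply: DeriveDef; first exact: e1.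
  rewrite -derive1E e2 /Rintegral.
  under eq_integral do rewrite d1E.
  by rewrite dphi_integral0.
have [] := @MVT R H (fun=> 0) 0 1 ltr01.
- by move=> x; rewrite in_itv/= => /andP[x0 x1]; apply: dH; apply/andP; split; lra.
- apply: derivable_within_continuous => x; rewrite in_itv/= => /andP[x0 x1].
  by have [] : is_derive x 1 H 0 by apply: dH; apply/andP; split; lra.
- by move=> x _ /eqP; rewrite mul0r subr_eq0 => /eqP.
Qed.

(** Completing the square leaves the integral of [phi 1], which is that of [phi 0],
the real Gaussian. *)
Lemma cintegral_gauss :
  cintegrable mu setT (fun x => cexp (A * x%:C - (x ^+ 2 / (2 * g))%:C)) /\
  cintegral mu setT (fun x => cexp (A * x%:C - (x ^+ 2 / (2 * g))%:C)) =
  cexp ((g / 2)%:C * A ^+ 2) *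
    (fine (\int[mu]_x (expR (- (x ^+ 2 / (2 * g))))%:E)%E)%:C.
Proof.
have h0 : -1 < (0 : R) < 2 by lra.
have h1 : -1 < (1 : R) < 2 by lra.
have E x : cexp (A * x%:C - (x ^+ 2 / (2 * g))%:C) = cexp ((g / 2)%:C * A ^+ 2) * phi 1 x.
  by rewrite /phi -cexpD; congr cexp; rewrite rmorph1 expr1n mulr1; ring.
have P0 x : phi 0 x = (expR (- (x ^+ 2 / (2 * g))))%:C.
  rewrite /phi -cexp_real; congr cexp.
  rewrite (_ : g * 0 ^+ 2 / 2 = 0); last by ring.
  by rewrite rmorph0 !mul0r sub0r subr0 rmorphN.
have e : cintegral mu setT (phi 1) = cintegral mu setT (phi 0).
  apply: eq_cpx.
    have E1 s : Re (cintegral mu setT (phi s)) = (\int[mu]_(x in setT) Re (1 * phi s x))%R.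
      by apply: eq_Rintegral => x _; rewrite mul1r.
    by rewrite !E1 phi_integral.
  have iI z : Re (- 'i%C * z) = Im z by case: z => u v /=; ring.
  have E1 s : Im (cintegral mu setT (phi s)) = (\int[mu]_(x in setT) Re (- 'i%C * phi s x))%R.
    by apply: eq_Rintegral => x _; rewrite iI.
  by rewrite !E1 phi_integral.
under [X in cintegrable _ _ X]eq_fun do rewrite E.
split; first by apply: cintegrableZl => //; exact: intphi.
under [X in cintegral _ _ X]eq_fun do rewrite E.
rewrite cintegralZl//; last exact: intphi.
rewrite e (funext P0); congr (_ * _); apply: eq_cpx; rewrite /cintegral//=.
rewrite (_ : (\int[_]_(p in _) _ = 0)%E)//.
exact: integral0_eq.
Qed.

End ComplexGaussian.

(** * Taylor estimate and derivative of the complex exponential *)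

Section ComplexExponential.
Context {R : realType}.
Local Notation C := R[i].

Lemma is_derive_continuous_itv (h dh : R -> R) :
  (forall t : R, 0 <= t <= 1 -> is_derive t 1 h (dh t)) ->
  {within `[0, 1], continuous h}.
Proof.
move=> H; apply: derivable_within_continuous => t; rewrite in_itv/= => /H [h1 _].
exact: h1.
Qed.

(** The mean value theorem fails for complex values, so that it is applied to the real
and to the imaginary part, hence the factor 2. *)
Lemma cderive_bound (f df : R -> C) (K : R) :
  (forall t : R, 0 <= t <= 1 -> is_cderive f t (df t)) ->
  (forall t : R, 0 <= t <= 1 -> normc (df t) <= K) ->
  normc (f 1 - f 0) <= 2 * K.
Proof.
move=> df1 dK; apply: le_trans (normc_le_ReIm _) _.
have H (h dh : R -> R) : (forall t : R, 0 <= t <= 1 -> is_derive t 1 h (dh t)) ->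
    (forall t : R, 0 <= t <= 1 -> `|dh t| <= K) -> `|h 1 - h 0| <= K.
  move=> dh1 dhK; have [||c] := @MVT R h dh 0 1 ltr01.
  - by move=> x; rewrite in_itv/= => /andP[x0 x1]; apply: dh1; rewrite !ltW.
  - exact: is_derive_continuous_itv dh1.
  by rewrite in_itv/= => /andP[c0 c1] ->; rewrite subr0 mulr1 dhK// !ltW.
have hR : `|Re (f 1 - f 0)| <= K.
  rewrite cReD cReN; apply: (H (fun t => Re (f t)) (fun t => Re (df t))).
    by move=> t /df1 [].
  by move=> t /dK; apply: le_trans; exact: Re_le_normc.
have hI : `|Im (f 1 - f 0)| <= K.
  rewrite cImD cImN; apply: (H (fun t => Im (f t)) (fun t => Im (df t))).
    by move=> t /df1 [].
  by move=> t /dK; apply: le_trans; exact: Im_le_normc.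
lra.
Qed.

Let cexp_line (h : C) (t : R) : is_cderive (fun t : R => cexp (t%:C * h)) t (h * cexp (t%:C * h)).
Proof.
apply: is_cderive_cexp.
apply: (is_cderive_eq (is_cderiveM (is_cderive_id t) (is_cderive_cst h t))).
by rewrite mul1r mulr0 addr0.
Qed.

Lemma cexp_sub1_bound (h : C) : normc (cexp h - 1) <= 2 * (normc h * expR (normc h)).
Proof.
have := @cderive_bound (fun t : R => cexp (t%:C * h)) _ (normc h * expR (normc h))
  (fun t _ => cexp_line h t).
rewrite rmorph1 mul1r rmorph0 mul0r cexp0; apply => t /andP[t0 t1].
rewrite Normc.normcM ler_wpM2l ?normc_ge0// normc_cexp ler_expR.
apply: le_trans (ler_norm _) _; apply: le_trans (Re_le_normc _) _.
by rewrite Normc.normcM normc_real ger0_norm// ler_piMl// normc_ge0.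
Qed.

(** The mean value inequality along the segment from 0 to [h], twice. This estimate
gives the derivative of [cexp] as well as the limits of [sinh (s * t) / s] and of
[(1 + c n) ^+ n] below. *)
Lemma cexp_taylor (h : C) :
  normc (cexp h - 1 - h) <= 4 * (normc h ^+ 2 * expR (normc h)).
Proof.
have D (t : R) : is_cderive (fun t : R => cexp (t%:C * h) - t%:C * h) t (h * (cexp (t%:C * h) - 1)).
  apply: (is_cderive_eq (is_cderiveB (cexp_line h t) (is_cderiveM (is_cderive_id t) (is_cderive_cst h t)))).
  by ring.
have := @cderive_bound _ _ (2 * (normc h ^+ 2 * expR (normc h))) (fun t _ => D t).
rewrite rmorph1 mul1r rmorph0 mul0r cexp0 subr0.
have -> : 2 * (2 * (normc h ^+ 2 * expR (normc h))) = 4 * (normc h ^+ 2 * expR (normc h)) by ring.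
rewrite [cexp h - h - 1]addrAC; apply => t /andP[t0 t1].
rewrite Normc.normcM; apply: (@le_trans _ _ (normc h * (2 * (normc h * expR (normc h))))); last first.
  by rewrite expr2; lra.
rewrite ler_wpM2l ?normc_ge0//; apply: le_trans (cexp_sub1_bound _) _.
have le1 : normc (t%:C * h) <= normc h.
  by rewrite Normc.normcM normc_real ger0_norm// ler_piMl// normc_ge0.
by rewrite ler_wpM2l// ler_pM ?normc_ge0 ?expR_ge0// ler_expR.
Qed.

Lemma derivable_cexp (a z : C) : derivable ((fun w => cexp (a * w)) : C^o -> C^o) z 1.
Proof.
apply/cvg_ex; exists (a * cexp (a * z)); apply/cvgrPdist_lt => /= e e0.
have [d ed] : exists d : R, e = d%:C by exists (Re e); rewrite RRe_real// gtr0_real.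
have d0 : 0 < d by rewrite -ltcR -ed.
pose M := normc (cexp (a * z)) * (4 * (normc a ^+ 2 * expR (normc a))).
have M0 : 0 <= M by rewrite !mulr_ge0 ?normc_ge0 ?expR_ge0 ?exprn_ge0 ?normc_ge0.
have dM : 0 < d / (M + 1) by rewrite divr_gt0// ltr_wpDl.
near=> h.
have h0 : h != 0 by near: h; first [exact: (@nbhs_dnbhs_neq C^o 0)|exact: (@nbhs_dnbhs_neq C 0)|exact: withinT].
have h1 : normc h < 1.
  by rewrite -normc_lt1; near: h; exact: (@dnbhs0_lt C C^o).
have h2 : normc h < d / (M + 1).
  by rewrite -ltr_normc; near: h; apply: (@dnbhs0_lt C C^o); rewrite ltcR.
rewrite ed ltr_normc.
have -> : a * cexp (a * z) - h^-1 *: (cexp (a * (h *: 1 + z)) - cexp (a * z)) =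
    - (cexp (a * z) * h^-1 * (cexp (a * h) - 1 - a * h)).
  have sc (u v : C) : u *: (v : C^o) = u * v by [].
  by rewrite !sc mulr1 [a * (h + z)]mulrDr cexpD; field.
rewrite normc_opp Normc.normcM [normc (_ / _)]Normc.normcM Normc.normcV.
apply: (@le_lt_trans _ _ (M * normc h)); last first.
  apply: (@le_lt_trans _ _ ((M + 1) * normc h)).
    by rewrite ler_wpM2r ?normc_ge0// lerDl.
  by rewrite mulrC -ltr_pdivlMr// ltr_wpDl.
have hn : 0 < normc h by rewrite normc_gt0.
rewrite mulrAC ler_pdivrMr//.
have -> : M * normc h * normc h =
    normc (cexp (a * z)) * (4 * ((normc a * normc h) ^+ 2 * expR (normc a))).
  by rewrite /M; ring.
rewrite ler_wpM2l ?normc_ge0//; apply: le_trans (cexp_taylor _) _.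
rewrite Normc.normcM ler_wpM2l// ler_wpM2l ?sqr_ge0// ler_expR.
by rewrite ler_piMr ?normc_ge0// ltW.
Unshelve. all: by end_near. Qed.

End ComplexExponential.

(** * Exponentials in the Fock space *)

Section FockInnerProduct.
Context {R : realType}.
Local Notation C := R[i].
Local Notation mu := (@lebesgue_measure R).
Variable g : R.
Hypothesis g0 : 0 < g.

Let G0 := fine (\int[mu]_x (expR (- (x ^+ 2 / (2 * g))))%:E)%E.

(** The total mass of the Gaussian weight of the Fock space. It cancels in the
coefficients of unit vectors. *)
Definition fock_mass : R := G0 * G0 / (2 * pi * g).

Lemma fock_mass_gt0 : 0 < fock_mass.
Proof.
have [_ h] := integral_gauss g0.
by rewrite divr_gt0 ?mulr_gt0// pi_gt0.
Qed.

(** The integrand splits into Gaussians in [x] and in [y], with linear coefficients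
[P + Q] and ['i * (P - Q)]; the squares of these add up to [4 * (P * Q)]. *)
Lemma cintegral_fock_kernel (P Q : C) :
  let F := fun p : R * R => let z := p.1 +i* p.2 in cexp (P * z + Q * z^*) *
    (expR (- (normc z ^+ 2 / (2 * g))) / (2 * pi * g))%:C in
  cintegrable plane_measure setT F /\
  cintegral plane_measure setT F = cexp ((2 * g)%:C * (P * Q)) * fock_mass%:C.
Proof.
move=> F.
pose f1 (x : R) := cexp ((P + Q) * x%:C - (x ^+ 2 / (2 * g))%:C).
pose f2 (y : R) := cexp (('i%C * (P - Q)) * y%:C - (y ^+ 2 / (2 * g))%:C).
have FE : F = fun p => ((2 * pi * g)^-1)%:C * (f1 p.1 * f2 p.2).
  apply/funext => -[x y]; rewrite /F [(_ / _)%:C]realcM -cexp_real [LHS]mulrCA mulrA [LHS]mulrC; congr (_ * _).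
  rewrite /f1 /f2 -!cexpD normcE2; congr cexp.
  by apply: eq_cpx; rewrite !cReImE /=; field; rewrite ?gt_eqF.
have [i1 e1] := cintegral_gauss (P + Q) g0.
have [i2 e2] := cintegral_gauss ('i%C * (P - Q)) g0.
have [i12 e12] := cintegral_prod_fun i1 i2.
rewrite FE; split.
  exact: (cintegrableZl (mu := plane_measure)).
rewrite (cintegralZl (mu := plane_measure))// e12 e1 e2 -/G0.
rewrite mulrACA -cexpD /fock_mass.
have -> : (g / 2)%:C * (P + Q) ^+ 2 + (g / 2)%:C * ('i%C * (P - Q)) ^+ 2 = (2 * g)%:C * (P * Q).
  have -> : ('i%C * (P - Q)) ^+ 2 = - (P - Q) ^+ 2 by rewrite exprMn sqr_i mulN1r.
  have -> : (2 * g)%:C = 4 * (g / 2)%:C :> C.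
    by rewrite -(rmorph_nat (@real_complex_def R _)) -rmorphM; congr (_ %:C); field.
  by ring.
by rewrite !realcM; ring.
Qed.

Lemma fock_dot_exp (a b P Q : C) :
  fock_dot g (fun w => a * cexp (P * w)) (fun w => b * cexp (Q * w)) =
  a * b^* * (cexp ((2 * g)%:C * (P * Q^*)) * fock_mass%:C).
Proof.
have [i e] := cintegral_fock_kernel P Q^*.
rewrite -e -(cintegralZl (mu := plane_measure))// /fock_dot.
congr cintegral; apply/funext => p /=.
rewrite conjcM cexpJ conjcM cexpD; ring.
Qed.

Lemma fock_stateE (z : C) : fock_state g z = fun w => 1 * cexp (z^* / (2 * g)%:C * w).
Proof. by apply/funext => w; rewrite /fock_state mul1r mulrAC. Qed.

Lemma holomorphic_exp (a P : C) (D : set C) :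
  holomorphic_on D (fun w => a * cexp (P * w)).
Proof.
move=> z _; apply: (@derivableM _ C^o (fun=> a) (fun w => cexp (P * w))).
  exact: derivable_cst.
exact: derivable_cexp.
Qed.

Lemma fock_space_exp (a P : C) : fock_space g (fun w => a * cexp (P * w)).
Proof.
split; first exact: holomorphic_exp.
have [[ir _] _] := cintegral_fock_kernel P P^*.
have := integrableZl measurableT (normc a ^+ 2) ir.
move=> /(integrable_lty measurableT); congr (_ < _)%E; apply: eq_integral => p _.
rewrite -EFinM; congr EFin; cbv zeta.
rewrite [X in Re X]mulrC cReMr Normc.normcM exprMn.
have -> : cexp (P * (p.1 +i* p.2) + P^* * (p.1 +i* p.2)^*) = (normc (cexp (P * (p.1 +i* p.2))) ^+ 2)%:C.
  by rewrite cexpD -mulcJ cexpJ conjcM.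
by rewrite (Re_realc (normc _ ^+ 2)); ring.
Qed.

Lemma fock_hnorm2 (z : C) : hnorm (fock g) (fock_state g z) ^+ 2 =
  expR (normc z ^+ 2 / (2 * g)) * fock_mass.
Proof.
have D : fock_dot g (fock_state g z) (fock_state g z) = (expR (normc z ^+ 2 / (2 * g)) * fock_mass)%:C.
  rewrite fock_stateE fock_dot_exp mul1r rmorph1 mul1r [RHS]realcM -cexp_real; congr (cexp _ * _).
  have g2 : (2 * g)%:C != 0 :> C by rewrite realc_eq0 mulf_neq0// gt_eqF.
  rewrite [(_ / _)^*]conjcM -realcV conjc_realc conjCK.
  by rewrite [RHS]realcM -mulcJ realcV; field; rewrite realc_eq0 gt_eqF.
have {}D : dot (fock g) (fock_state g z) (fock_state g z) = _ := D.
rewrite /hnorm D Re_realc sqr_sqrtr// mulr_ge0 ?expR_ge0//.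
exact/ltW/fock_mass_gt0.
Qed.

End FockInnerProduct.

(** * Limits of complex-valued functions *)

Section ComplexLimits.
Context {R : realType}.
Local Notation C := R[i].

(** The norm of the field [C] takes its values in [C]; this lemma and the next move
between convergence for that norm and convergence of the real-valued modulus,
for which squeezing is available. *)
Lemma cvg_normc (T : Type) (F : set_system T) (FF : Filter F) (u : T -> C) (l : C) :
  normc (u x - l) @[x --> F] --> (0 : R) -> (u : T -> C^o) @ F --> (l : C^o).
Proof.
move=> h; apply/cvgrPdist_lt => e e0.
have [d ed] : exists d : R, e = d%:C by exists (Re e); rewrite RRe_real// gtr0_real.
have d0 : 0 < d by rewrite -ltcR -ed.
move/cvgrPdist_lt: h => /(_ _ d0); apply: filterS => x.
by rewrite sub0r normrN ger0_norm ?normc_ge0// ed -normrN opprB ltr_normc.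
Qed.

Lemma cvg_to_normc (T : Type) (F : set_system T) (FF : Filter F) (u : T -> C) (l : C) :
  (u : T -> C^o) @ F --> (l : C^o) -> normc (u x - l) @[x --> F] --> (0 : R).
Proof.
move=> h; apply/cvgrPdist_lt => d d0.
have e0 : 0 < d%:C :> C by rewrite ltcR.
move/cvgrPdist_lt: h => /(_ _ e0); apply: filterS => x H.
by rewrite sub0r normrN ger0_norm ?normc_ge0// -ltr_normc -normrN opprB.
Qed.

Lemma cvg_realc (T : Type) (F : set_system T) (FF : Filter F) (u : T -> R) (l : R) :
  u @ F --> l -> ((fun x => (u x)%:C) : T -> C^o) @ F --> (l%:C : C^o).
Proof.
move=> h; apply: cvg_normc.
have -> : (fun x => normc ((u x)%:C - l%:C)) = (fun x => `|u x - l|).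
  by apply/funext => x; rewrite -rmorphB normc_real.
by rewrite -(normr0 R); apply: cvg_norm; apply/subr_cvg0.
Qed.

Lemma cvg_complex (T : Type) (F : set_system T) (FF : Filter F) (u v : T -> R) (a b : R) :
  u @ F --> a -> v @ F --> b ->
  ((fun x => u x +i* v x) : T -> C^o) @ F --> ((a +i* b) : C^o).
Proof.
move=> ua vb.
have E x y : x +i* y = x%:C + 'i%C * y%:C :> C.
  by apply: eq_cpx; rewrite !cReImE/=; ring.
rewrite E; under eq_fun do rewrite E.
apply: cvgD; first exact: cvg_realc.
by apply: cvgM; [exact: cvg_cst|exact: cvg_realc].
Qed.

Lemma cvg_Re (T : Type) (F : set_system T) (FF : Filter F) (u : T -> C) (l : C) :
  (u : T -> C^o) @ F --> (l : C^o) -> Re (u x) @[x --> F] --> Re l.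
Proof.
move=> /cvg_to_normc h; apply/subr_cvg0; apply: norm_cvg0.
apply: (@squeeze_cvgr _ _ _ _ (cst 0) (fun x => normc (u x - l))) => //.
  by apply: nearW => x; rewrite normr_ge0/= -cReN -cReD Re_le_normc.
exact: cvg_cst.
Qed.

Lemma cvg_Im (T : Type) (F : set_system T) (FF : Filter F) (u : T -> C) (l : C) :
  (u : T -> C^o) @ F --> (l : C^o) -> Im (u x) @[x --> F] --> Im l.
Proof.
move=> /cvg_to_normc h; apply/subr_cvg0; apply: norm_cvg0.
apply: (@squeeze_cvgr _ _ _ _ (cst 0) (fun x => normc (u x - l))) => //.
  by apply: nearW => x; rewrite normr_ge0/= -cImN -cImD Im_le_normc.
exact: cvg_cst.
Qed.

Lemma cvgcMl (c : C) (u : nat -> C) (l : C) :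
  (u : nat -> C^o) @ \oo --> (l : C^o) ->
  ((fun n => c * u n) : nat -> C^o) @ \oo --> (c * l : C^o).
Proof. by move=> h; apply: cvgM; [exact: cvg_cst|exact: h]. Qed.

End ComplexLimits.

(** * One-parameter subgroups of SU(1,1) *)

Section Hyperbolic.
Context {R : realType}.
Definition cosh (x : R) : R := (expR x + expR (- x)) / 2.
Definition sinh (x : R) : R := (expR x - expR (- x)) / 2.
End Hyperbolic.

Section MatrixExponential.
Context {R : realType}.
Local Notation C := R[i].

(** Even powers of [M] are scalar and odd ones are multiples of [M], so that the
exponential series splits into the series of [cosh] and [sinh]. *)
Lemma expmx_sqr_scalar m (M : 'M[C]_m.+1) (s t : R) : s != 0 ->
  M * M = (s ^+ 2)%:C *: 1 ->
  expmx (t%:C *: M) = (cosh (s * t))%:C *: 1 + (sinh (s * t) / s)%:C *: M.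
Proof.
move=> s0 MM.
have two0 : 2 != 0 :> R by rewrite pnatr_eq0.
have Mk k : M ^+ k = ((s ^+ k + (- s) ^+ k) / 2)%:C *: 1 + ((s ^+ k - (- s) ^+ k) / (2 * s))%:C *: M.
  elim: k => [|k IH].
    rewrite !expr0 subrr mul0r scale0r addr0.
    by rewrite (_ : (1 + 1) / 2 = 1 :> R) ?scale1r//; field.
  rewrite exprS IH mulrDr -!scalerAr MM mulr1 scalerA -rmorphM addrC.
  congr (_%:C *: _ + _%:C *: _).
    by rewrite !exprS; field.
  by rewrite !exprS; field.
pose al k := (exp_coeff (s * t) k + exp_coeff (- (s * t)) k) / 2.
pose be k := (exp_coeff (s * t) k - exp_coeff (- (s * t)) k) / (2 * s).
have term k : (k`!%:R^-1 : C) *: (t%:C *: M) ^+ k = (al k)%:C *: 1 + (be k)%:C *: M.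
  rewrite exprZn Mk scalerA scalerDr !scalerA.
  have -> : (k`!%:R^-1 : C) = (k`!%:R^-1 : R)%:C by rewrite realcV rmorph_nat.
  rewrite -rmorphXn -!realcM; congr (_%:C *: _ + _%:C *: _).
    by rewrite /al /exp_coeff /= -mulNr !exprMn; ring.
  by rewrite /be /exp_coeff /= -[- (s * t)]mulNr !exprMn; ring.
pose K : numFieldType := C; pose l : 'M[K]_m.+1 := (cosh (s * t))%:C *: 1 + (sinh (s * t) / s)%:C *: M.
suff L : (series (fun k => (k`!%:R^-1 : C) *: (t%:C *: M) ^+ k) : nat -> 'M[K]_m.+1) @ \oo --> l.
  exact: (cvg_lim (@norm_hausdorff _ _) L).
have -> : series (fun k => (k`!%:R^-1 : C) *: (t%:C *: M) ^+ k) =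
    (fun n => (series al n)%:C *: 1 + (series be n)%:C *: M).
  apply/funext => n; rewrite /series /=.
  under eq_bigr do rewrite term.
  by rewrite big_split /= !realc_sum !scaler_suml.
have ec (x : R) : series (exp_coeff x) @ \oo --> expR x.
  exact: is_cvg_series_exp_coeff.
have alc : series al @ \oo --> cosh (s * t).
  have -> : series al = (fun n => (series (exp_coeff (s * t)) n + series (exp_coeff (- (s * t))) n) / 2).
    by apply/funext => n; rewrite /series /= -big_split /= -mulr_suml.
  by apply: cvgM; [apply: cvgD; exact: ec|exact: cvg_cst].
have bec : series be @ \oo --> sinh (s * t) / s.
  have -> : series be = (fun n => (series (exp_coeff (s * t)) n - series (exp_coeff (- (s * t))) n) / (2 * s)).
    by apply/funext => n; rewrite /series /= -sumrB /= -mulr_suml.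
  rewrite /sinh -mulrA -invfM.
  by apply: cvgM; [apply: cvgB; exact: ec|exact: cvg_cst].
by apply: cvgD; apply: cvgZr_tmp; exact: cvg_realc.
Qed.

End MatrixExponential.

Section SU11Matrices.
Context {R : realType}.
Local Notation C := R[i].

(** An element of SU(1,1) when [a * a^* - b * b^* = 1]. *)
Definition su11_mx (a b : C) : 'M[C]_2 := mx2 a b b^* a^*.

Lemma mx2_mul (a b c d a' b' c' d' : C) : mx2 a b c d *m mx2 a' b' c' d' =
  mx2 (a * a' + b * c') (a * b' + b * d') (c * a' + d * c') (c * b' + d * d').
Proof.
apply/matrixP => i j; rewrite !mxE !big_ord_recl big_ord0 addr0 !mxE /=.
by case: i => -[|[|//]] ? /=; case: j => -[|[|//]] ? /=.
Qed.

Lemma mx2_1 : 1%:M = mx2 1 0 0 1 :> 'M[C]_2.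
Proof.
by apply/matrixP => i j; rewrite !mxE; case: i => -[|[|//]] ? /=; case: j => -[|[|//]] ?.
Qed.

Lemma su11_mx_inv (a b : C) : a * a^* - b * b^* = 1 ->
  invmx (su11_mx a b) = mx2 a^* (- b) (- b^*) a.
Proof.
move=> ab; set G := su11_mx a b; set G' := mx2 _ _ _ _.
have GG : G *m G' = 1%:M.
  by rewrite /G /G' mx2_mul mx2_1 -{1}ab; congr mx2; rewrite -?ab; ring.
have [uG _] := mulmx1_unit GG.
by rewrite -[RHS]mul1mx -(mulVmx uG) -mulmxA GG mulmx1.
Qed.

(** SU(1,1) preserves the hermitian form [|x|^2 - |y|^2], here evaluated at the image of
the vector [(1, u)]. *)
Lemma su11_gap (a b u : C) : a * a^* - b * b^* = 1 ->
  normc (a + b * u) ^+ 2 - normc (b^* + a^* * u) ^+ 2 = 1 - normc u ^+ 2.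
Proof.
move=> ab; apply: (@complexI R).
rewrite !realcB realc1 -!mulcJ !conjcD !conjcM !conjCK.
transitivity ((a * a^* - b * b^*) * (1 - u * u^*)); first by ring.
by rewrite ab mul1r.
Qed.

Lemma su11_gap_lt (a b u : C) : a * a^* - b * b^* = 1 -> normc u < 1 ->
  normc (b^* + a^* * u) < normc (a + b * u).
Proof.
move=> ab u1; rewrite -(@ltr_pXn2r _ 2)// ?nnegrE ?normc_ge0//.
by rewrite -subr_gt0 su11_gap// subr_gt0 expr_lt1// normc_ge0.
Qed.

(** Elements of su(1,1) have trace zero, so by Cayley-Hamilton their square is a
scalar, minus the determinant. *)
Lemma lie_contractionE (r : R) (X : 'rV[R]_3) (s : R) :
  s ^+ 2 = r ^+ 2 * (X 0 0 ^+ 2 + X 0 1 ^+ 2 - r ^+ 2 * X 0 2%:R ^+ 2) / 4 ->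
  let M := lie_contraction r X in
  M = su11_mx (0 -i* (r ^+ 2 * X 0 2%:R / 2)) ((r * X 0 1 / 2) -i* (r * X 0 0 / 2)) /\
  M * M = (s ^+ 2)%:C *: 1.
Proof.
move=> s2 M.
have ME : M = su11_mx (0 -i* (r ^+ 2 * X 0 2%:R / 2)) ((r * X 0 1 / 2) -i* (r * X 0 0 / 2)).
  have h : (2%:R : C)^-1 = (2^-1 : R)%:C by rewrite realcV rmorph_nat.
  rewrite /M /lie_contraction /u1 /u2 /u3 h.
  apply/matrixP => i j; rewrite !mxE.
  case: i => -[|[|//]] ? /=; case: j => -[|[|//]] ? /=;
  by apply: eq_cpx; rewrite ?cReImE /= ?cReImE /=; field.
split=> //; rewrite ME [LHS]mx2_mul.
rewrite (_ : (1 : 'M[C]_2) = mx2 1 0 0 1); last exact: mx2_1.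
apply/matrixP => i j; rewrite !mxE.
case: i => -[|[|//]] ? /=; case: j => -[|[|//]] ? /=;
by apply: eq_cpx; rewrite ?cReImE /= ?s2; field.
Qed.

Lemma expmx_lie_contraction (r : R) (X : 'rV[R]_3) (s t : R) : s != 0 ->
  s ^+ 2 = r ^+ 2 * (X 0 0 ^+ 2 + X 0 1 ^+ 2 - r ^+ 2 * X 0 2%:R ^+ 2) / 4 ->
  let S := sinh (s * t) / s in
  let a := cosh (s * t) -i* (r ^+ 2 * X 0 2%:R / 2 * S) in
  let b := (r * X 0 1 / 2 * S) -i* (r * X 0 0 / 2 * S) in
  expmx (t%:C *: lie_contraction r X) = su11_mx a b /\ a * a^* - b * b^* = 1.
Proof.
move=> s0 s2 S a b.
have [ME MM] := lie_contractionE s2.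
rewrite (expmx_sqr_scalar t s0 MM) ME; split.
  rewrite (_ : (1 : 'M[C]_2) = mx2 1 0 0 1); last exact: mx2_1.
  apply/matrixP => i j; rewrite !mxE.
  case: i => -[|[|//]] ? /=; case: j => -[|[|//]] ? /=;
  by apply: eq_cpx; rewrite /a /b /S ?cReImE /=; ring.
apply: eq_cpx; rewrite /a /b ?cReImE /=; last by ring.
have e1 : expR (s * t) * expR (- (s * t)) = 1 by rewrite -expRD subrr expR0.
transitivity (cosh (s * t) ^+ 2 - s ^+ 2 * S ^+ 2); first by rewrite s2; field.
by rewrite /S /cosh /sinh -[RHS]e1; field.
Qed.

End SU11Matrices.

(** * Matrix coefficients of coherent states *)

Section DiscInnerProduct.
Context {R : realType}.
Local Notation C := R[i].
Local Notation I f := (cintegral plane_measure plane_disc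
  (fun p : R * R => f (p.1 +i* p.2))).

(** The weight of the inner product has exponent [n - 2], which is why the powers
[N.+2] are matched by the mass [disc_mass N]. *)
Lemma disc_dot_kernel N (c d w A B : C) : normc w < 1 -> normc B < normc A ->
  disc_dot N.+2 (fun z => if `|z| < 1 then c * (A - B * z) ^- N.+2 else 0)
    (fun z => if `|z| < 1 then d * (1 - z * w^*) ^- N.+2 else 0) =
  c * d^* * (N.+1%:R / pi)%:C * ((A - B * w) ^- N.+2 * disc_mass N).
Proof.
move=> w1 AB; rewrite -[(A - B * w) ^- _]exprVn -(cintegral_kernel _ w1 AB).
have mD := @measurable_plane_disc R.
rewrite -(cintegralZl (mu := plane_measure))//; last first.
  apply: (@disc_regular_integrable _ (fun z => (1 - z * z^*) ^+ N *
     (1 - w * z^*)^-1 ^+ N.+2 * (A - B * z)^-1 ^+ N.+2)).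
  apply: disc_regularM; [apply: disc_regularM|]; apply: disc_regularX.
  - exact: disc_regular_weight.
  - exact: disc_regular_affineVJ.
  - exact: disc_regular_affineV.
apply: eq_cintegral => p pD; have p1 : `|p.1 +i* p.2| < 1 := pD; cbv zeta.
rewrite p1 (_ : (N.+2 - 2)%N = N) ?subn2// (_ : N.+2.-1 = N.+1)// conjcM.
rewrite realcM realcX realcB realc1 -mulcJ.
have -> : ((1 - (p.1 +i* p.2) * w^*) ^- N.+2)^* = (1 - w * (p.1 +i* p.2)^*)^-1 ^+ N.+2.
  by rewrite conjcV conjcXn conjcB conjc_one conjcM conjCK exprVn [_^* * w]mulrC.
by rewrite !exprVn; ring.
Qed.

Lemma disc_stateE N (w : C) : disc_state N w =
  fun z => if `|z| < 1 then 1 * (1 - z * w^*) ^- N else 0.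
Proof. by apply/funext => z; rewrite /disc_state mul1r. Qed.

Lemma disc_hnorm2 N (w : C) : normc w < 1 ->
  hnorm (disc_hilbert N.+2) (disc_state N.+2 w) ^+ 2 =
  (N.+1%:R / pi) * ((1 - normc w ^+ 2) ^- N.+2 * Re (disc_mass N)) :> R.
Proof.
move=> w1; have w1' : normc w^* < normc (1 : C) by rewrite normc_conj Normc.normc1.
have [m0 mi] := @disc_mass_gt0 R N.
have D : dot (disc_hilbert N.+2) (disc_state N.+2 w) (disc_state N.+2 w) =
   ((N.+1%:R / pi) * ((1 - normc w ^+ 2) ^- N.+2 * Re (disc_mass N)))%:C.
  have := disc_dot_kernel N 1 1 w1 w1'.
  have <- : disc_state N.+2 w = (fun z => if `|z| < 1 then 1 * (1 - w^* * z) ^- N.+2 else 0).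
    by rewrite disc_stateE; apply/funext => z; rewrite [z * _]mulrC.
  rewrite -disc_stateE => D; rewrite [LHS]D; set k := _ / pi.
  rewrite conjc_one !mul1r !realcM [(_ ^- _)%:C]realcV realcX realcB realc1 -mulcJ [w^* * w]mulrC.
  by congr (_ * (_ * _)); exact: eq_cpx.
rewrite /hnorm D Re_realc sqr_sqrtr//.
have w2 : 0 < 1 - normc w ^+ 2 by rewrite subr_gt0 expr_lt1// normc_ge0.
by rewrite mulr_ge0 ?divr_ge0 ?pi_ge0// mulr_ge0 ?(ltW m0)// invr_ge0 exprn_ge0// ltW.
Qed.

Lemma derivable_expn (f : C^o -> C^o) (z : C^o) n : derivable f z 1 ->
  derivable ((fun x => f x ^+ n) : C^o -> C^o) z 1.
Proof.
move=> df; elim: n => [|n IH].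
  exact: (@derivable_cst C C^o C^o 1).
have -> : (fun x => f x ^+ n.+1) = (fun x => f x * f x ^+ n).
  by apply/funext => x; rewrite exprS.
exact: (@derivableM C C^o f _ z 1 df IH).
Qed.

Lemma disc_space_state N (c w : C) : normc w < 1 ->
  disc_space N.+2 (fun z => if `|z| < 1 then c * (1 - z * w^*) ^- N.+2 else 0).
Proof.
move=> w1; split.
- move=> z z1.
  have W0 : (1 - z * w^*) ^+ N.+2 != 0.
    rewrite expf_neq0// [z * _]mulrC; apply: affine_neq0.
      by rewrite normc_conj Normc.normc1.
    by rewrite ltW// -normc_lt1.
  apply: (@near_eq_derivable C C^o C^o (fun z => c * (1 - z * w^*) ^- N.+2)).
    apply/(@nbhs_normP C C^o); exists (1 - `|z|); first by rewrite /= subr_gt0.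
    move=> y /= yz; rewrite ifT// (@le_lt_trans _ _ (`|z| + `|z - y|))//; last first.
      by rewrite -ltrBrDl.
    by rewrite -[X in `|X| <= _](subKr z y) (le_trans (ler_normB _ _)).
  apply: (@derivableM C C^o (fun=> c) (fun z => (1 - z * w^*) ^- N.+2)); first exact: derivable_cst.
  apply: (@derivableV C C^o (fun z : C^o => (1 - z * w^*) ^+ N.+2 : C^o)) => //.
  apply: derivable_expn.
  apply: (@derivableB C C^o C^o (fun=> 1) (fun z => z * w^*)); first exact: derivable_cst.
  apply: (@derivableM C C^o id (fun=> w^*)); [exact: derivable_id|exact: derivable_cst].
- by move=> z; rewrite /disc => /negP/negbTE ->.
- have w1' : normc w^* < normc (1 : C) by rewrite normc_conj Normc.normc1.
  have reg : disc_regular (fun z => (1 - z * z^*) ^+ N *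
     (1 - w * z^*)^-1 ^+ N.+2 * (1 - w^* * z)^-1 ^+ N.+2).
    apply: disc_regularM; [apply: disc_regularM|]; apply: disc_regularX.
    - exact: disc_regular_weight.
    - exact: disc_regular_affineVJ.
    - exact: disc_regular_affineV.
  have mD := @measurable_plane_disc R.
  have [ir _] := disc_regular_integrable reg.
  have := integrableZl mD (normc c ^+ 2 * (N.+1%:R / pi)) ir.
  move=> /(integrable_lty mD); congr (_ < _)%E; apply: eq_integral => p.
  rewrite inE => pD; have p1 : `|p.1 +i* p.2| < 1 := pD; cbv zeta.
  rewrite p1 (_ : (N.+2 - 2)%N = N) ?subn2// (_ : N.+2.-1 = N.+1)// -EFinM; congr EFin.
  set z := p.1 +i* p.2.
  have -> : (1 - z * z^*) ^+ N * (1 - w * z^*)^-1 ^+ N.+2 * (1 - w^* * z)^-1 ^+ N.+2 =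
     ((1 - normc z ^+ 2) ^+ N * normc ((1 - z * w^*)^-1 ^+ N.+2) ^+ 2)%:C.
    rewrite realcM realcX realcB realc1 -!mulcJ -mulrA; congr (_ * _).
    rewrite [w^* * z]mulrC [RHS]mulrC; congr (_ * _).
    by rewrite conjcXn conjcV conjcB conjc_one conjcM conjCK [w * _]mulrC.
  by rewrite Re_realc -[_ ^- N.+2]exprVn [normc (c * _)]Normc.normcM; ring.
Qed.

(** The automorphy factor clears the denominators of the Moebius transformation, and
leaves the power of another affine function. By [su11_gap_lt] that function has
no zero on the closed disc. *)
Lemma disc_rep_state N (c w a b : C) : a * a^* - b * b^* = 1 -> normc w < 1 ->
  disc_rep N.+2 (su11_mx a b)
    (fun z => if `|z| < 1 then c * (1 - z * w^*) ^- N.+2 else 0) =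
  fun z => if `|z| < 1 then
    c * ((a + b * w^*) - (b^* + a^* * w^*) * z) ^- N.+2 else 0.
Proof.
move=> ab w1; apply/funext => z; rewrite /disc_rep su11_mx_inv//.
case: ifPn => // z1.
have ab' : a * a^* - b^* * (b^*)^* = 1 by rewrite conjCK [b^* * b]mulrC.
have zN : normc (- z) < 1 by rewrite normc_opp -normc_lt1.
have := su11_gap_lt ab' zN; rewrite conjCK !mulrN => gap.
have n0 : a - b^* * z != 0 by rewrite -normc_gt0; apply: le_lt_trans gap; exact: normc_ge0.
rewrite /su11_act !mxE /=.
have actE : (a^* * z + - b) / (- b^* * z + a) = - ((b - a^* * z) / (a - b^* * z)).
  by field; exact: n0.
rewrite actE normc_lt1 normc_opp Normc.normcM Normc.normcV ltr_pdivrMr ?mul1r; last first.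
  by rewrite normc_gt0.
rewrite gap mulrCA; congr (c * _).
rewrite -invfM -exprMn; congr (_ ^- _).
by field.
Qed.

(** The reproducing property evaluates at [w] the affine function produced by the
group element; [1 - |w|^2] and the cancellation of [disc_mass] come from the
normalisation. *)
Lemma disc_coherent_coef N (w a b : C) : a * a^* - b * b^* = 1 -> normc w < 1 ->
  disc_space N.+2 (disc_unit_state N.+2 w) /\
  disc_dot N.+2 (disc_rep N.+2 (su11_mx a b) (disc_unit_state N.+2 w))
    (disc_unit_state N.+2 w) =
  ((a + b * w^* - (b^* + a^* * w^*) * w) / (1 - normc w ^+ 2)%:C) ^- N.+2.
Proof.
move=> ab w1.
pose c : C := ((hnorm (disc_hilbert N.+2) (disc_state N.+2 w))^-1)%:C.
have uE : disc_unit_state N.+2 w = fun z => if `|z| < 1 then c * (1 - z * w^*) ^- N.+2 else 0.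
  apply/funext => z; rewrite /disc_unit_state /hnormalize /disc_state.
  by rewrite -[LHS]/(c * _); case: ifP => // _; rewrite mulr0.
rewrite uE disc_rep_state//; split; first exact: disc_space_state.
have wJ : normc w^* < 1 by rewrite normc_conj.
rewrite disc_dot_kernel//; last exact: su11_gap_lt.
have [m0 mi] := @disc_mass_gt0 R N.
have mE : @disc_mass R N = (Re (@disc_mass R N))%:C by exact: eq_cpx.
have w2 : 0 < 1 - normc w ^+ 2 by rewrite subr_gt0 expr_lt1// normc_ge0.
have pi0 : (0 : R) < pi := pi_gt0 R.
have cc : c * c^* = ((N.+1%:R / pi) * ((1 - normc w ^+ 2) ^- N.+2 * Re (disc_mass N)))^-1%:C.
  by rewrite /c conjc_realc -realcM -invfM -expr2 disc_hnorm2.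
rewrite cc mE; set T := a + _ - _; set v := 1 - normc w ^+ 2; set k := _ / pi.
have -> : (T / v%:C) ^- N.+2 = T ^- N.+2 * (v ^+ N.+2)%:C.
  by rewrite exprMn invfM exprVn invrK realcX.
transitivity (((k * (v ^- N.+2 * Re (disc_mass N)))^-1 * k * Re (disc_mass N))%:C * T ^- N.+2).
  by rewrite !realcM; ring.
rewrite [LHS]mulrC; congr (_ * _%:C); field.
apply/and3P; split.
- by rewrite expf_neq0// gt_eqF.
- exact: lt0r_neq0.
- by rewrite /k mulf_neq0 ?invr_eq0 ?pnatr_eq0// gt_eqF.
Qed.

End DiscInnerProduct.

Section FockCoefficient.
Context {R : realType}.
Local Notation C := R[i].

(** The group element multiplies the exponential [cexp (Q * w)] by a constant [cexp K]
and moves its frequency from [Q] to [P], so that the coefficient is an inner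
product of two exponentials. *)
Lemma fock_coherent_coef (g : R) (z : C) (h : heis) : 0 < g ->
  fock_space g (fock_unit_state g z) /\
  fock_dot g (fock_rep g h (fock_unit_state g z)) (fock_unit_state g z) =
  cexp (- (g * (h1 h ^+ 2 + h2 h ^+ 2) / 4) +i* (g * h3 h + h1 h * Re z + h2 h * Im z)).
Proof.
move=> g0; pose c : C := ((hnorm (fock g) (fock_state g z))^-1)%:C.
pose Q : C := z^* / (2 * g)%:C.
have g2 : (2 * g)%:C != 0 :> C by rewrite realc_eq0 mulf_neq0// gt_eqF.
have uE : fock_unit_state g z = fun w => c * cexp (Q * w).
  by apply/funext => w; rewrite -[LHS]/(c * fock_state g z w) fock_stateE mul1r.
rewrite uE; split; first exact: fock_space_exp.
case: h => b1 b2 b3 /=.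
pose P : C := Q + (b2%:C + b1%:C * 'i%C) / 2.
pose K : C := 'i%C * (b3 * g)%:C + 4%:R^-1 * (- b2%:C - b1%:C * 'i%C) * (g%:C * (b2%:C - b1%:C * 'i%C)) +
  Q * (g%:C * (- b2%:C + 'i%C * b1%:C)).
have rE : fock_rep g (Heis b1 b2 b3) (fun w => c * cexp (Q * w)) = fun w => (c * cexp K) * cexp (P * w).
  apply/funext => w; rewrite /fock_rep /heis_alpha /heis_act /heis_inv.
  rewrite [LHS]mulrCA -cexpD -[RHS]mulrA -cexpD; congr (c * cexp _).
  rewrite [h1 _]/= [h2 _]/= [h3 _]/= !realcM !rmorphN /K /P.
  have q : (4%:R^-1 : C) = 2^-1 * 2^-1 by field.
  by rewrite q; field.
rewrite rE fock_dot_exp//.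
have m0 := fock_mass_gt0 g0.
have cc : c * c^* = ((expR (normc z ^+ 2 / (2 * g)) * fock_mass g)^-1)%:C.
  by rewrite /c conjc_realc -realcM -invfM -expr2 fock_hnorm2.
have -> : c * cexp K * c^* * (cexp ((2 * g)%:C * (P * Q^*)) * (fock_mass g)%:C) =
    cexp (K + (2 * g)%:C * (P * Q^*)) * ((c * c^*) * (fock_mass g)%:C).
  by rewrite cexpD; ring.
have em : (expR (normc z ^+ 2 / (2 * g)) * fock_mass g)^-1 * fock_mass g =
    expR (- (normc z ^+ 2 / (2 * g))).
  by rewrite expRN invfM -mulrA mulVf ?mulr1// gt_eqF.
rewrite cc -realcM em -cexp_real -cexpD.
congr cexp.
have QJ : (2 * g)%:C * (P * Q^*) = P * z.
  by rewrite /Q conjcM conjcV conjc_realc conjCK; field; rewrite realc_eq0 gt_eqF.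
have -> : (- (normc z ^+ 2 / (2 * g)))%:C = - (Q * z).
  by rewrite (rmorphN (@real_complex_def R _)) -[X in - X]/(_%:C) realcM realcV -mulcJ /Q; ring.
have -> : K + (2 * g)%:C * (P * Q^*) - Q * z = K + (b2%:C + b1%:C * 'i%C) / 2 * z.
  by rewrite QJ /P; ring.
rewrite /K.
have -> : Q * (g%:C * (- b2%:C + 'i%C * b1%:C)) = z^* * (- b2%:C + 'i%C * b1%:C) / 2.
  by rewrite /Q realcM; field; rewrite realc_eq0 gt_eqF.
have h2 : (2%:R : C)^-1 = (2^-1 : R)%:C by rewrite realcV rmorph_nat.
have h4 : (4%:R : C)^-1 = (4^-1 : R)%:C by rewrite realcV rmorph_nat.
rewrite h2 h4; clear; case: z => x y.
by apply: eq_cpx; rewrite /= ?cReImE /= ?cReImE /=; field.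
Qed.

End FockCoefficient.

Section SpectralCoefficient.
Context {R : realType} {V : lmodType R[i]}.

(** This bypasses the spectral integral: a generator satisfies [rho t = exp (itA)], so
its coefficients are matrix coefficients of the one-parameter group. *)
Lemma spectral_coef_generator (H : hilbert V) (rho : R -> V -> V) A E (f : V) :
  is_generator H rho A E -> Defs.space H f ->
  spectral_coef H E f = fun t => dot H (rho (- t) f) f.
Proof. by move=> [_ _ h] Hf; apply/funext => t; rewrite /spectral_coef h. Qed.

End SpectralCoefficient.

(** * Hyperbolic functions and the compound-interest limit *)

Section HyperbolicEstimates.
Context {R : realType}.
Local Notation C := R[i].
Local Notation mu := (@lebesgue_measure R).

Lemma cosh_ge1 (x : R) : 1 <= cosh x.
Proof. by have := expR_ge1Dx x; have := expR_ge1Dx (- x); rewrite /cosh; lra. Qed.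

Lemma sinhN (x : R) : sinh (- x) = - sinh x.
Proof. by rewrite /sinh opprK; ring. Qed.

Lemma coshE (x : R) : cosh x = 1 + 2 * sinh (x / 2) ^+ 2.
Proof.
have e1 : expR (x / 2) * expR (- (x / 2)) = 1 by rewrite -expRD subrr expR0.
have -> : cosh x = (expR (x / 2) ^+ 2 + expR (- (x / 2)) ^+ 2) / 2.
  by rewrite /cosh -!expRM_natl /=; congr ((expR _ + expR _) / _); field.
by rewrite /sinh -[in X in _ = X + _]e1; field.
Qed.

Lemma sinh_ge (x : R) : 0 <= x -> x <= sinh x.
Proof.
rewrite le_eqVlt => /orP[/eqP <-|x0]; first by rewrite /sinh oppr0 subrr mul0r.
have D (y : R) : is_derive y 1 (fun y => sinh y - y) (cosh y - 1).
  have E : (fun y => sinh y - y) = 2^-1 \*: (expR - (expR \o -%R)) - id :> (R -> R).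
    by apply/funext => t; rewrite /sinh mulrC.
  by rewrite E; apply: is_derive_eq; rewrite /cosh /GRing.scale/=; ring.
have [|c] := @MVT R (fun y => sinh y - y) _ 0 x x0 (fun y _ => D y).
  by apply: derivable_within_continuous => y _; case: (D y).
rewrite in_itv/= => /andP[c0 _].
have s00 : sinh (0 : R) = 0 by rewrite /sinh oppr0 subrr mul0r.
rewrite s00 !subr0 => h.
by rewrite -subr_ge0 h mulr_ge0//; [rewrite subr_ge0 cosh_ge1|exact: ltW].
Qed.

Lemma cosh_ge (x : R) : 1 + x ^+ 2 / 2 <= cosh x.
Proof.
rewrite coshE lerD2l.
have h : (x / 2) ^+ 2 <= sinh (x / 2) ^+ 2.
  rewrite -[(x / 2) ^+ 2](real_normK (num_real _)) -[sinh _ ^+ 2](real_normK (num_real _)).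
  rewrite ler_pXn2r ?nnegrE//; have [x0|x0] := leP 0 (x / 2).
    by rewrite !ger0_norm ?sinh_ge// (le_trans x0)// sinh_ge.
  have y0 : 0 <= - (x / 2) by rewrite oppr_ge0 ltW.
  rewrite -normrN -[`|sinh _|]normrN -sinhN ger0_norm// ger0_norm ?sinh_ge//.
  exact: le_trans y0 (sinh_ge y0).
by move: h; rewrite expr_div_n; lra.
Qed.

Lemma bernoulli_ge (u : R) n : 0 <= u -> 1 + n%:R * u <= (1 + u) ^+ n.
Proof.
move=> u0; elim: n => [|n IH]; first by rewrite mul0r addr0 expr0.
rewrite exprS; apply: (@le_trans _ _ ((1 + u) * (1 + n%:R * u))).
  have -> : (1 + u) * (1 + n%:R * u) = 1 + n.+1%:R * u + n%:R * u * u.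
    by rewrite -natr1; ring.
  by rewrite lerDl !mulr_ge0.
by rewrite ler_wpM2l// addr_ge0.
Qed.

Lemma sinh_sub_bound (y : R) : `|sinh y - y| <= 4 * (y ^+ 2 * expR `|y|).
Proof.
have e (x : R) : `|expR x - 1 - x| <= 4 * (x ^+ 2 * expR `|x|).
  have := cexp_taylor (x%:C); rewrite cexp_real -realc1 -!realcB !normc_real.
  by rewrite real_normK ?num_real.
have := e y; have := e (- y); rewrite sqrrN normrN => h1 h2.
have -> : sinh y - y = ((expR y - 1 - y) - (expR (- y) - 1 - - y)) / 2.
  by rewrite /sinh; field.
rewrite normrM (@ger0_norm _ 2^-1)//.
apply: (@le_trans _ _ ((`|expR y - 1 - y| + `|expR (- y) - 1 - - y|) / 2)).
  by rewrite ler_pM2r// ler_normB.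
lra.
Qed.

Lemma cvg_sinh (s : nat -> R) (t : R) : s n @[n --> \oo] --> (0 : R) ->
  (\forall n \near \oo, 0 < s n) ->
  sinh (s n * t) / s n @[n --> \oo] --> t.
Proof.
move=> s0 sp; apply/subr_cvg0; apply: norm_cvg0.
apply: (@squeeze_cvgr _ _ _ _ (cst 0) (fun n => s n * (4 * (t ^+ 2 * expR `|t|)))).
- near=> n; rewrite normr_ge0/=.
  have sn : 0 < s n by near: n.
  have sn1 : s n <= 1.
    near: n; move/cvgr_le: s0; apply; exact: ltr01.
  have -> : sinh (s n * t) / s n - t = (sinh (s n * t) - s n * t) / s n.
    by field; rewrite gt_eqF.
  rewrite normrM [`|(s n)^-1|]gtr0_norm ?invr_gt0// ler_pdivrMr//.
  apply: le_trans (sinh_sub_bound _) _.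
  have -> : s n * (4 * (t ^+ 2 * expR `|t|)) * s n = 4 * ((s n * t) ^+ 2 * expR `|t|) by ring.
  rewrite ler_wpM2l// ler_wpM2l ?sqr_ge0// ler_expR normrM gtr0_norm//.
  by rewrite ler_piMl.
- exact: cvg_cst.
- rewrite -[X in _ --> X](mul0r (4 * (t ^+ 2 * expR `|t|))).
  by apply: cvgM; [exact: s0|exact: cvg_cst].
Unshelve. all: by end_near. Qed.

Lemma cvg_invn : (n%:R^-1 : R) @[n --> \oo] --> (0 : R).
Proof. by rewrite -cvg_shiftS; exact: cvg_harmonic. Qed.

(** [1 + c n] is compared with [cexp (L / n)]. With [K = |L| + 1] both have modulus at
most [exp (K / n)] for large [n], so each term in the factorisation of the difference
of their [n]-th powers is at most [exp K], while [n] times the difference of the two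
bases tends to 0 by [cexp_taylor]. *)
Lemma cvg_compound (c : nat -> C) (L : C) :
  ((fun n => n%:R * c n) : nat -> C^o) @ \oo --> (L : C^o) ->
  ((fun n => (1 + c n) ^+ n) : nat -> C^o) @ \oo --> (cexp L : C^o).
Proof.
move=> /cvg_to_normc h; apply: cvg_normc.
pose K := normc L + 1.
pose B := 4 * (normc L ^+ 2 * expR (normc L)).
apply: (@squeeze_cvgr _ _ _ _ (cst 0)
  (fun n => expR K * (normc (n%:R * c n - L) + B * n%:R^-1))).
- near=> n; rewrite normc_ge0/=.
  have n0 : (0 < n)%N by near: n; exists 1%N.
  have n0R : 0 < n%:R :> R by rewrite ltr0n.
  have nC : (n%:R : C) = (n%:R)%:C by rewrite rmorph_nat.
  have nC0 : (n%:R : C) != 0 by rewrite pnatr_eq0 -lt0n.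
  have h1 : normc (n%:R * c n - L) < 1 by near: n; move/cvgr_lt: h; apply; exact: ltr01.
  have nK : normc (n%:R * c n) <= K.
    have := normc_leD (n%:R * c n - L) L; rewrite subrK /K => h2; lra.
  pose x := 1 + c n; pose y := cexp (L / n%:R); pose M := expR (K / n%:R).
  have yn : y ^+ n = cexp L.
    by rewrite -cexpMn; congr cexp; rewrite -[LHS]mulr_natr divfK.
  have Mn : M ^+ n = expR K by rewrite -expRM_natl mulrC divfK// gt_eqF.
  have M1 : 1 <= M.
    by rewrite -expR0 ler_expR divr_ge0// /K addr_ge0// normc_ge0.
  have normcn : normc (n%:R : C) = n%:R by rewrite nC normc_real ger0_norm.
  have xM : normc x <= M.
    apply: le_trans (normc_leD _ _) _; rewrite Normc.normc1.
    apply: (@le_trans _ _ (1 + K / n%:R)); last exact: expR_ge1Dx.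
    by rewrite lerD2l ler_pdivlMr// mulrC -normcn -Normc.normcM.
  have yM : normc y <= M.
    rewrite normc_cexp ler_expR; apply: le_trans (ler_norm _) _.
    apply: le_trans (Re_le_normc _) _.
    rewrite Normc.normcM Normc.normcV normcn ler_pM2r ?invr_gt0//.
    by rewrite /K lerDl.
  rewrite -yn subrXX Normc.normcM.
  have S : normc (\sum_(i < n) x ^+ (n.-1 - i) * y ^+ i) <= n%:R * expR K.
    apply: le_trans (normc_sum _ _ _) _.
    rewrite -[n in n%:R](card_ord n) -sumr_const mulr_suml; apply: ler_sum => i _.
    rewrite mul1r -Mn Normc.normcM !normcX.
    apply: (@le_trans _ _ (M ^+ (n.-1 - i) * M ^+ i)).
      by apply: ler_pM; rewrite ?exprn_ge0 ?normc_ge0//; apply: lerXn2r;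
        rewrite ?nnegrE ?normc_ge0// (le_trans (normc_ge0 _) xM).
    have e : (n.-1 - i + i)%N = n.-1 by rewrite subnK// -ltnS prednK.
    by rewrite -exprD e ler_weXn2l ?leq_pred.
  apply: le_trans (ler_wpM2l (normc_ge0 _) S) _.
  rewrite mulrA [_ * expR K]mulrC ler_wpM2l ?expR_ge0//.
  have -> : normc (x - y) * n%:R = normc ((n%:R * c n - L) - n%:R * (y - 1 - L / n%:R)).
    rewrite -normcn -Normc.normcM; congr normc; rewrite /x; by field.
  apply: le_trans (normc_leB _ _) _; rewrite lerD2l.
  rewrite Normc.normcM normcn /y.
  apply: (@le_trans _ _ (n%:R * (4 * (normc (L / n%:R) ^+ 2 * expR (normc (L / n%:R)))))).
    by rewrite ler_wpM2l// cexp_taylor.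
  have nL : normc (L / n%:R) = normc L / n%:R by rewrite Normc.normcM Normc.normcV normcn.
  rewrite nL.
  have -> : n%:R * (4 * ((normc L / n%:R) ^+ 2 * expR (normc L / n%:R))) =
     4 * (normc L ^+ 2 * expR (normc L / n%:R)) / n%:R by field; rewrite gt_eqF.
  rewrite ler_pM2r ?invr_gt0// /B ler_wpM2l// ler_wpM2l ?sqr_ge0// ler_expR.
  by rewrite ler_pdivrMr// ler_peMr ?normc_ge0// ler1n.
- exact: cvg_cst.
- rewrite -[X in _ --> X](mulr0 (expR K)).
  apply: cvgM; first exact: cvg_cst.
  rewrite -[X in _ --> X](addr0 0); apply: cvgD => //.
  rewrite -[X in _ --> X](mulr0 B); apply: cvgM; first exact: cvg_cst.
  exact: cvg_invn.
Unshelve. all: by end_near. Qed.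

End HyperbolicEstimates.

(** * Dominated convergence on the line *)

Section DominatedConvergence.
Context {R : realType}.
Local Notation C := R[i].
Local Notation mu := (@lebesgue_measure R).

Lemma integrable_oneDsqrV : mu.-integrable setT (EFin \o (fun t : R => (1 + t ^+ 2)^-1)).
Proof.
have cf : continuous (fun t : R => (1 + t ^+ 2)^-1) by exact: continuous_oneDsqrV.
have p0 (t : R) : 0 <= (1 + t ^+ 2)^-1 by rewrite invr_ge0 addr_ge0 ?sqr_ge0.
apply/integrableP; split.
  by apply/measurable_EFinP; exact: continuous_measurable_fun.
under eq_integral do rewrite /= ger0_norm//.
rewrite (@ge0_symfun_integralT R (fun t => (1 + t ^+ 2)^-1))//; last first.
  by move=> t /=; rewrite sqrrN.
have -> : [set x : R | (0 <= x)%R] = `[0, +oo[%classic.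
  by apply/seteqP; split => x /=; rewrite in_itv/= andbT.
by rewrite integral0y_oneDsqr -EFinM ltry.
Qed.

Lemma dominated_cvg_line (u : nat -> R -> R) (v G : R -> R) :
  (\forall n \near \oo, measurable_fun setT (u n)) ->
  measurable_fun setT v -> mu.-integrable setT (EFin \o G) ->
  (\forall n \near \oo, forall t, `|u n t| <= G t) ->
  (forall t, u n t @[n --> \oo] --> v t) ->
  fine (\int[mu]_t (u n t)%:E) @[n --> \oo] --> fine (\int[mu]_t (v t)%:E).
Proof.
(* The hypotheses hold from a certain rank on only, hence the shift by [N]. *)
move=> [N1 _ mu_] mv iG [N2 _ uG] uv; pose N := maxn N1 N2.
have mN n : measurable_fun setT (EFin \o u (n + N)%N).
  by apply/measurable_EFinP; apply: mu_ => /=; apply: leq_trans (leq_maxl N1 N2) (leq_addl _ _).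
have dN n t : `|u (n + N)%N t| <= G t.
  by apply: uG => /=; apply: leq_trans (leq_maxr N1 N2) (leq_addl _ _).
have mv' : measurable_fun setT (EFin \o v) by exact/measurable_EFinP.
have ae1 : {ae mu, forall t, setT t -> (fun n => EFin \o u (n + N)%N) ^~ t @ \oo --> (EFin \o v) t}.
  apply: aeW => t _; apply: cvg_EFin; first exact: nearW.
  have := uv t; rewrite -(cvg_shiftn N); exact.
have ae2 : {ae mu, forall t n, setT t -> (`|((fun n => EFin \o u (n + N)%N) n t)| <= (EFin \o G) t)%E}.
  by apply: aeW => t n _; rewrite /= lee_fin.
have [iv _ h] := @dominated_convergence _ (measurableTypeR R) R mu setT measurableT
  (fun n => EFin \o u (n + N)%N) (EFin \o v) (EFin \o G) mN mv' ae1 iG ae2.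
rewrite -(cvg_shiftn N).
apply: (@fine_cvg _ _ _ _ (fun n => (\int[mu]_t (u (n + N)%N t)%:E)%E)).
rewrite fineK; first exact: h.
exact: integrable_fin_num.
Qed.

Lemma dominated_cvg_cintegral (u : nat -> R -> C) (v : R -> C) (G : R -> R) :
  (\forall n \near \oo, measurable_cfun (u n : measurableTypeR R -> C)) ->
  measurable_cfun (v : measurableTypeR R -> C) -> mu.-integrable setT (EFin \o G) ->
  (\forall n \near \oo, forall t, normc (u n t) <= G t) ->
  (forall t, ((fun n => u n t) : nat -> C^o) @ \oo --> (v t : C^o)) ->
  ((fun n => cintegral mu setT (u n)) : nat -> C^o) @ \oo --> (cintegral mu setT v : C^o).
Proof.
move=> mu_ [mvr mvi] iG uG uv; apply: cvg_complex.
  apply: (dominated_cvg_line (G := G)) => //.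
  - by apply: filterS mu_ => n [].
  - by apply: filterS uG => n h t; exact: le_trans (Re_le_normc _) (h t).
  - by move=> t; exact: cvg_Re (uv t).
apply: (dominated_cvg_line (G := G)) => //.
- by apply: filterS mu_ => n [].
- by apply: filterS uG => n h t; exact: le_trans (Im_le_normc _) (h t).
- by move=> t; exact: cvg_Im (uv t).
Qed.

End DominatedConvergence.

Lemma cvg_near_eq (T : topologicalType) (u v : nat -> T) (l : T) :
  (\forall n \near \oo, u n = v n) -> v @ \oo --> l -> u @ \oo --> l.
Proof.
move=> uv vl; apply: cvg_trans vl; apply: near_eq_cvg.
by apply: filterS uv => n ->.
Qed.

(** * The two families of coefficients and their limit *)

Section CoherentCoefficients.
Context {R : realType}.
Local Notation C := R[i].
Local Notation mu := (@lebesgue_measure R).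
Variables (g a1 a2 a3 : R) (z : C) (r : nat -> R).
Hypotheses (g0 : 0 < g) (ha : (a1, a2) <> (0, 0)).
Hypothesis hr : forall n, (2 < n)%N -> 0 < r n /\ n%:R * r n ^+ 2 = 2 * g.

Let rho2 := a1 ^+ 2 + a2 ^+ 2.
(* [n * disc_s2 n] tends to [4 * k]; once it exceeds [2 * k], one has
   [n * disc_s2 n * t ^+ 2 / 2 >= k * t ^+ 2]. *)
Let k := g * rho2 / 8.
Let theta := - (g * a3 + a1 * Re z + a2 * Im z).

Let rho2_gt0 : 0 < rho2.
Proof.
rewrite /rho2 lt_neqAle addr_ge0 ?sqr_ge0// andbT eq_sym paddr_eq0 ?sqr_ge0//.
by rewrite !sqrf_eq0; apply/negP => /andP[/eqP h1 /eqP h2]; apply: ha; rewrite h1 h2.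
Qed.

Let k0 : 0 < k. Proof. by rewrite /k divr_gt0// mulr_gt0. Qed.

Definition fock_coef (t : R) : C := cexp (- (g * rho2 / 4 * t ^+ 2) +i* (theta * t)).

(** Minus the determinant of the image of [X] under the contraction of parameter [r n],
whose exponential is hyperbolic when this number is positive. *)
Definition disc_s2 n : R := r n ^+ 2 * (rho2 - r n ^+ 2 * a3 ^+ 2) / 4.
Definition disc_s n : R := Num.sqrt (disc_s2 n).
Definition disc_pt n : C := z / (Num.sqrt (2 * g * n%:R))%:C.
Definition disc_q n : R := normc (disc_pt n) ^+ 2.
Definition disc_kappa n : R :=
  ((1 + disc_q n) * (r n ^+ 2 * a3 / 2) + r n * (a1 * Re (disc_pt n) + a2 * Im (disc_pt n)))
    / (1 - disc_q n).
(** [1 + disc_incr n t] is [cosh (s * t) + i * kappa * sinh (s * t) / s]; singling out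
the increment to 1 prepares for [cvg_compound]. *)
Definition disc_incr n t : C :=
  (cosh (disc_s n * t) - 1) +i* (disc_kappa n * (sinh (disc_s n * t) / disc_s n)).
Definition disc_coef n t : C := (1 + disc_incr n t) ^- n.

(** Dominates [(1 + k * t ^+ 2)^-1] by a constant multiple of [(1 + t ^+ 2)^-1], since
[1 + t ^+ 2 <= (1 + k^-1) * (1 + k * t ^+ 2)]. *)
Definition coef_bound (t : R) : R := (1 + k^-1) * (1 + t ^+ 2)^-1.

Lemma coef_bound_integrable : mu.-integrable setT (EFin \o coef_bound).
Proof.
rewrite /coef_bound /comp; under eq_fun do rewrite EFinM.
by apply: integrableZl => //; exact: integrable_oneDsqrV.
Qed.

Let coef_boundP (t u : R) : 1 + k * t ^+ 2 <= u -> u^-1 <= coef_bound t.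
Proof.
move=> h; have t2 := sqr_ge0 t.
have kt : 0 <= k * t ^+ 2 by rewrite mulr_ge0// ltW.
have u0 : 0 < u by apply: lt_le_trans h; rewrite ltr_wpDr.
rewrite /coef_bound -[leRHS]mulrC ler_pdivlMl; last by rewrite ltr_wpDr.
rewrite ler_pdivrMr//; apply: (@le_trans _ _ ((1 + k^-1) * (1 + k * t ^+ 2))).
  have -> : (1 + k^-1) * (1 + k * t ^+ 2) = (1 + t ^+ 2) + (k * t ^+ 2 + k^-1).
    by field; rewrite gt_eqF.
  by rewrite lerDl addr_ge0// invr_ge0 ltW.
by rewrite ler_wpM2l// addr_ge0// invr_ge0 ltW.
Qed.

Lemma fock_coef_bound t : normc (fock_coef t) <= coef_bound t.
Proof.
rewrite normc_cexp [Re _]/= expRN; apply: coef_boundP.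
apply: le_trans (expR_ge1Dx _); rewrite lerD2l ler_wpM2r ?sqr_ge0//.
by rewrite /k; have := mulr_gt0 g0 rho2_gt0; lra.
Qed.

Lemma measurable_fock_coef : measurable_cfun (fock_coef : measurableTypeR R -> C).
Proof.
apply: measurable_cfun_cexp; split => /=; last exact: measurable_funM.
by apply: measurable_funN; apply: measurable_funM => //; exact: measurable_funX.
Qed.

Lemma measurable_disc_coef n : measurable_cfun (disc_coef n : measurableTypeR R -> C).
Proof.
have me (a : R) : measurable_fun setT (fun t : measurableTypeR R => expR (a * t)).
  by apply: measurableT_comp.
have me' (a : R) : measurable_fun setT (fun t : measurableTypeR R => expR (- (a * t))).
  by apply: measurableT_comp => //; apply: measurable_funN; exact: measurable_funM.
apply: measurable_cfunV; apply: measurable_cfunX; apply: measurable_cfunD.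
  exact: measurable_cfun_cst.
split => /=.
  apply: measurable_funB => //; apply: measurable_funM => //; exact: measurable_funD.
apply: measurable_funM => //; apply: measurable_funM => //.
by apply: measurable_funM => //; exact: measurable_funB.
Qed.

Let nr2 n : (2 < n)%N -> r n ^+ 2 = 2 * g * n%:R^-1.
Proof.
move=> n2; have [_ h] := hr n2; have n0 : (n%:R : R) != 0 by rewrite pnatr_eq0; case: n n2 h.
by rewrite -h mulrC mulKf.
Qed.

Let sqrtE n : (2 < n)%N -> Num.sqrt (2 * g * n%:R) = n%:R * r n.
Proof.
move=> n2; have [r0 h] := hr n2.
have -> : 2 * g * n%:R = (n%:R * r n) ^+ 2 by rewrite -h; ring.
by rewrite sqrtr_sqr ger0_norm// mulr_ge0// ltW.
Qed.

Let qE n : (2 < n)%N -> disc_q n = normc z ^+ 2 / (2 * g) * n%:R^-1.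
Proof.
move=> n2; have [r0 h] := hr n2.
have n0 : (n%:R : R) != 0 by rewrite pnatr_eq0; case: n n2 {h r0}.
rewrite /disc_q /disc_pt Normc.normcM Normc.normcV normc_real sqrtE//.
rewrite exprMn exprVn real_normK ?num_real// exprMn nr2//.
by field; rewrite n0 gt_eqF.
Qed.

Let near2 : \forall n \near \oo, (2 < n)%N.
Proof. by exists 3%N. Qed.

Let cvg_q : disc_q n @[n --> \oo] --> (0 : R).
Proof.
apply: (cvg_near_eq (v := fun n => normc z ^+ 2 / (2 * g) * n%:R^-1)).
  by apply: filterS near2 => n; exact: qE.
rewrite -[X in _ --> X](mulr0 (normc z ^+ 2 / (2 * g))).
by apply: cvgM; [exact: cvg_cst|exact: cvg_invn].
Qed.

Let cvg_ns2 : n%:R * disc_s2 n @[n --> \oo] --> g * rho2 / 2.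
Proof.
apply: (cvg_near_eq (v := fun n => g / 2 * (rho2 - (2 * g * a3 ^+ 2) * n%:R^-1))).
  apply: filterS near2 => n n2; rewrite /disc_s2 nr2//.
  have n0 : (n%:R : R) != 0 by rewrite pnatr_eq0; case: n n2.
  by field.
have -> : g * rho2 / 2 = g / 2 * (rho2 - (2 * g * a3 ^+ 2) * 0) by field.
apply: cvgM; first exact: cvg_cst.
apply: cvgB; first exact: cvg_cst.
by apply: cvgM; [exact: cvg_cst|exact: cvg_invn].
Qed.

Let near_ns2 : \forall n \near \oo, (2 < n)%N /\ 2 * k < n%:R * disc_s2 n.
Proof.
apply: filterI; first exact: near2.
apply: (cvgr_gt _ cvg_ns2); rewrite /k.
by have := mulr_gt0 g0 rho2_gt0; lra.
Qed.

Let s2_gt0 n : (2 < n)%N -> 2 * k < n%:R * disc_s2 n -> 0 < disc_s2 n.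
Proof.
move=> n2 h; have n0 : 0 < (n%:R : R) by rewrite ltr0n; case: n n2 {h}.
by rewrite -(pmulr_rgt0 _ n0); apply: lt_trans h; rewrite mulr_gt0.
Qed.

Let s2E n : 0 < disc_s2 n -> disc_s n ^+ 2 = disc_s2 n.
Proof. by move=> h; rewrite sqr_sqrtr// ltW. Qed.

Let cvg_s : disc_s n @[n --> \oo] --> (0 : R).
Proof.
have h : disc_s2 n @[n --> \oo] --> (0 : R).
  apply: (cvg_near_eq (v := fun n => (n%:R * disc_s2 n) * n%:R^-1)).
    apply: filterS near2 => n n2; have n0 : (n%:R : R) != 0 by rewrite pnatr_eq0; case: n n2.
    by field.
  rewrite -[X in _ --> X](mulr0 (g * rho2 / 2)).
  by apply: cvgM; [exact: cvg_ns2|exact: cvg_invn].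
rewrite -(sqrtr0 R); apply: (cvg_comp _ Num.sqrt h).
exact: sqrt_continuous.
Qed.

Let near_s : \forall n \near \oo, 0 < disc_s n.
Proof.
by apply: filterS near_ns2 => n [n2 h]; rewrite sqrtr_gt0; exact: s2_gt0 h.
Qed.

(* Half-angle form: [cosh x - 1] is twice the square of [sinh (x / 2)]. *)
Let cvg_cosh t : n%:R * (cosh (disc_s n * t) - 1) @[n --> \oo] --> g * rho2 / 4 * t ^+ 2.
Proof.
apply: (cvg_near_eq (v := fun n => 2 * (n%:R * disc_s2 n) * (sinh (disc_s n * (t / 2)) / disc_s n) ^+ 2)).
  apply: filterS near_ns2 => n [n2 h]; have s2 := s2_gt0 n2 h.
  rewrite -(s2E s2) coshE -[disc_s n * t / 2]mulrA; have s0 : disc_s n != 0 by rewrite gt_eqF// sqrtr_gt0.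
  by field.
have -> : g * rho2 / 4 * t ^+ 2 = 2 * (g * rho2 / 2) * (t / 2) ^+ 2 by field.
apply: cvgM; first by apply: cvgM; [exact: cvg_cst|exact: cvg_ns2].
rewrite !expr2; under eq_fun do rewrite expr2.
by apply: cvgM; apply: cvg_sinh.
Qed.

Let cvg_kappa : n%:R * disc_kappa n @[n --> \oo] --> - theta.
Proof.
apply: (cvg_near_eq (v := fun n => ((1 + disc_q n) * (g * a3) + (a1 * Re z + a2 * Im z)) * (1 - disc_q n)^-1)).
  apply: filterS near2 => n n2; have [r0 h] := hr n2.
  have n0 : (n%:R : R) != 0 by rewrite pnatr_eq0; case: n n2 {h r0}.
  rewrite /disc_kappa /disc_pt sqrtE// -realcV -[z * _]mulrC cReMr cImMr mulrA nr2//.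
  congr (_ * _); field; by rewrite n0 gt_eqF.
have -> : - theta = ((1 + 0) * (g * a3) + (a1 * Re z + a2 * Im z)) * (1 - 0)^-1.
  by rewrite /theta subr0 invr1; ring.
apply: cvgM.
  apply: cvgD; last exact: cvg_cst.
  apply: cvgM; last exact: cvg_cst.
  by apply: cvgD; [exact: cvg_cst|exact: cvg_q].
apply: cvgV; first by rewrite subr0.
by apply: cvgB; [exact: cvg_cst|exact: cvg_q].
Qed.

(** [n * disc_incr n t] has a limit, so its inverse power converges to an exponential. *)
Lemma cvg_disc_coef t : ((fun n => disc_coef n t) : nat -> C^o) @ \oo --> (fock_coef t : C^o).
Proof.
pose L : C := (g * rho2 / 4 * t ^+ 2) +i* (- theta * t).
have nc : ((fun n => n%:R * disc_incr n t) : nat -> C^o) @ \oo --> (L : C^o).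
  have -> : (fun n => n%:R * disc_incr n t) = (fun n => (n%:R * (cosh (disc_s n * t) - 1)) +i*
      ((n%:R * disc_kappa n) * (sinh (disc_s n * t) / disc_s n))).
    apply/funext => n; have -> : (n%:R : C) = (n%:R)%:C by rewrite rmorph_nat.
    by apply: eq_cpx; rewrite ?cReMr ?cImMr//= mulrA.
  apply: cvg_complex; first exact: cvg_cosh.
  by apply: cvgM; [exact: cvg_kappa|exact: cvg_sinh].
have -> : fock_coef t = (cexp L)^-1.
  by rewrite -cexpN; congr cexp; apply: eq_cpx; rewrite /L //= mulNr opprK.
apply: cvgV; first exact: cexp_neq0.
exact: cvg_compound.
Qed.

(** The modulus of [1 + disc_incr n t] is at least its real part, [cosh (s * t)], which
is at least [1 + s ^+ 2 * t ^+ 2 / 2]; Bernoulli's inequality then bounds its [n]-th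
power from below by [1 + n * s ^+ 2 * t ^+ 2 / 2], where [n * s ^+ 2] stays away from 0. *)
Lemma disc_coef_bound : \forall n \near \oo, forall t, normc (disc_coef n t) <= coef_bound t.
Proof.
apply: filterS near_ns2 => n [n2 h] t; have s2 := s2_gt0 n2 h.
rewrite /disc_coef Normc.normcV normcX; apply: coef_boundP.
apply: (@le_trans _ _ ((1 + disc_s2 n * t ^+ 2 / 2) ^+ n)).
  apply: (@le_trans _ _ (1 + n%:R * (disc_s2 n * t ^+ 2 / 2))).
    rewrite lerD2l; have := ler_wpM2r (sqr_ge0 t) (ltW h); lra.
  by apply: bernoulli_ge; rewrite divr_ge0// mulr_ge0 ?sqr_ge0// ltW.
have s0 : 0 <= 1 + disc_s2 n * t ^+ 2 / 2.
  by rewrite addr_ge0// divr_ge0// mulr_ge0 ?sqr_ge0// ltW.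
apply: lerXn2r; rewrite ?nnegrE ?normc_ge0//.
apply: le_trans (le_trans (ler_norm _) (Re_le_normc _)).
have -> : Re (1 + disc_incr n t) = cosh (disc_s n * t) by rewrite cReD /=; ring.
by apply: le_trans (cosh_ge _); rewrite exprMn s2E.
Qed.

Lemma near_disc_regime :
  \forall n \near \oo, [/\ (2 < n)%N, normc (disc_pt n) < 1 & 0 < disc_s2 n].
Proof.
have q1 : \forall n \near \oo, disc_q n < 1 by move/cvgr_lt: cvg_q; apply; exact: ltr01.
apply: filterS2 near_ns2 q1 => n [n2 h] q; split => //; last exact: s2_gt0 h.
by move: q; rewrite /disc_q expr_lt1// normc_ge0.
Qed.

End CoherentCoefficients.

(** * Spectral coefficients of the two generators *)

Section Generators.
Context {R : realType}.
Local Notation C := R[i].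
Local Notation mu := (@lebesgue_measure R).
Variables (g a1 a2 a3 : R) (X : 'rV[R]_3).
Hypotheses (g0 : 0 < g) (hX : X = a1 *: v1 + a2 *: v2 + a3 *: v3).

Lemma coordE : [/\ X 0 0 = a1, X 0 1 = a2 & X 0 2%:R = a3].
Proof. by rewrite hX !mxE /=; split; ring. Qed.

Lemma fock_spectral_coef A E (z : C) :
  is_generator (fock g) (fun t => fock_rep g (exp_heis (t *: X))) A E ->
  spectral_coef (fock g) E (fock_unit_state g z) = fock_coef g a1 a2 a3 z.
Proof.
move=> hA; have [e1 e2 e3] := coordE.
have [sp _] := fock_coherent_coef z (Heis 0 0 0) g0.
rewrite (spectral_coef_generator hA sp); apply/funext => t.
have [_] := fock_coherent_coef z (exp_heis (- t *: X)) g0.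
move=> H; rewrite [LHS]H /fock_coef /exp_heis !mxE e1 e2 e3.
by congr cexp; apply: eq_cpx => /=; field.
Qed.

Lemma disc_spectral_coef (r : nat -> R) (z : C) n A E :
  0 < r n -> (2 < n)%N -> normc (disc_pt g z n) < 1 -> 0 < disc_s2 a1 a2 a3 r n ->
  is_generator (disc_hilbert n)
    (fun t => disc_rep n (expmx (t%:C *: lie_contraction (r n) X))) A E ->
  spectral_coef (disc_hilbert n) E (disc_unit_state n (disc_pt g z n)) =
  disc_coef g a1 a2 a3 z r n.
Proof.
move=> rn; case: n rn => [|[|N]]// rn _.
set n := N.+2; set w := disc_pt g z n => w1 s20 hA.
have [e1 e2 e3] := coordE.
have h10 : (1 : C) * 1^* - 0 * 0^* = 1 by rewrite rmorph1 rmorph0 mulr1 mulr0 subr0.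
have [sp _] := disc_coherent_coef N h10 w1.
rewrite (spectral_coef_generator hA sp); apply/funext => t.
have s0 : disc_s a1 a2 a3 r n != 0 by rewrite gt_eqF// sqrtr_gt0.
have s2 : disc_s a1 a2 a3 r n ^+ 2 = r n ^+ 2 * (X 0 0 ^+ 2 + X 0 1 ^+ 2 - r n ^+ 2 * X 0 2%:R ^+ 2) / 4.
  by rewrite sqr_sqrtr ?ltW// e1 e2 e3.
have [-> ab] := expmx_lie_contraction (- t) s0 s2.
have [_] := disc_coherent_coef N ab w1.
move=> H; rewrite [LHS]H {H sp} /disc_coef; congr (_ ^- _).
have q1 : 0 < 1 - normc w ^+ 2 by rewrite subr_gt0 expr_lt1// normc_ge0.
have chN (x : R) : cosh (- x) = cosh x by rewrite /cosh opprK addrC.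
have q0 : (1 - normc w ^+ 2)%:C != 0 :> C by rewrite realc_eq0 gt_eqF.
apply: (mulIf q0); rewrite divfK//.
rewrite /disc_incr /disc_kappa /disc_q -/w mulrN chN sinhN mulNr e1 e2 e3.
move: (cosh _) (sinh _ / _) q1 {q0} => ch S.
rewrite normcE2; case: w w1 => x y _ /= q1.
by apply: eq_cpx; rewrite /= ?cReImE /= ?cReImE /=; field; rewrite gt_eqF.
Qed.

End Generators.

Unset Implicit Arguments.
Set Strict Implicit.
Local Open Scope complex_scope.

Theorem proposition6p2 (R : realType) (gamma : R) (r : nat -> R)
  (a1 a2 a3 : R) (X : 'rV[R]_3)
  (A : operator (R[i] -> R[i]^o))
  (E : set R -> (R[i] -> R[i]^o) -> (R[i] -> R[i]^o))
  (A_ : nat -> operator (R[i] -> R[i]^o))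
  (E_ : nat -> set R -> (R[i] -> R[i]^o) -> (R[i] -> R[i]^o))
  (hgamma : 0 < gamma)
  (hr : forall n, (2 < n)%N -> 0 < r n /\ n%:R * r n ^+ 2 = 2 * gamma)
  (hX : X = a1 *: v1 + a2 *: v2 + a3 *: v3)
  (ha : (a1, a2) <> (0, 0))
  (hA : is_generator (fock gamma)
    (fun t => fock_rep gamma (exp_heis (t *: X))) A E)
  (hA_ : forall n, (2 < n)%N -> is_generator (disc_hilbert n)
    (fun t => disc_rep n (expmx (t%:C *: lie_contraction (r n) X))) (A_ n) (E_ n)) :
  forall (lambda : R) (z : R[i]),
  [/\ spectral_coef_integrable (fock gamma) E (fock_unit_state gamma z),
      (\forall n \near \oo, spectral_coef_integrable (disc_hilbert n) (E_ n)
        (disc_unit_state n (z / (Num.sqrt (2 * gamma * n%:R))%:C))) &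
      (fun n => spectral_density (disc_hilbert n) (E_ n)
        (disc_unit_state n (z / (Num.sqrt (2 * gamma * n%:R))%:C)) lambda
        : R[i]^o) @ \oo
      --> (spectral_density (fock gamma) E (fock_unit_state gamma z) lambda
        : R[i]^o)].
Proof.
move=> lambda z.
have coefF := fock_spectral_coef hgamma hX z hA.
have nearD : \forall n \near \oo, spectral_coef (disc_hilbert n) (E_ n)
    (disc_unit_state n (disc_pt gamma z n)) = disc_coef gamma a1 a2 a3 z r n.
  have := near_disc_regime a3 z hgamma ha hr; apply: filterS => n [n2 w1 s2].
  have [rn _] := hr _ n2.
  exact: disc_spectral_coef (hA_ _ n2).
have bI := coef_bound_integrable gamma a1 a2.
have bF := fock_coef_bound a3 z hgamma ha.
have bD := disc_coef_bound a3 z hgamma ha hr.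
split.
- rewrite /spectral_coef_integrable coefF.
  exact: (cintegrable_le measurableT (measurable_fock_coef _ _ _ _ _) bI (fun t _ => bF t)).
- apply: filterS2 nearD bD => n e h; rewrite /spectral_coef_integrable e.
  exact: (cintegrable_le measurableT (measurable_disc_coef _ _ _ _ _ _ _) bI (fun t _ => h t)).
- have mE : measurable_cfun (fun t : measurableTypeR R => cexp ('i%C * (t * lambda)%:C)).
    apply: measurable_cfun_cexp; apply: measurable_cfunM; first exact: measurable_cfun_cst.
    by apply: measurable_cfun_real; exact: measurable_funM.
  have nE t u : normc (cexp ('i%C * (t * lambda)%:C) * u) = normc u.
    by rewrite Normc.normcM normc_cexp cReM /= !mul0r mulr0 subr0 expR0 mul1r.
  have dI : ((fun n => cintegral lebesgue_measure setT
      (fun t : measurableTypeR R => cexp ('i%C * (t * lambda)%:C) * disc_coef gamma a1 a2 a3 z r n t))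
        : nat -> R[i]^o) @ \oo -->
      (cintegral lebesgue_measure setT
        (fun t : measurableTypeR R => cexp ('i%C * (t * lambda)%:C) * fock_coef gamma a1 a2 a3 z t)
        : R[i]^o).
    apply: (dominated_cvg_cintegral (G := coef_bound gamma a1 a2)) => //.
    + apply: nearW => n; apply: measurable_cfunM; first exact: mE.
      exact: measurable_disc_coef.
    + by apply: measurable_cfunM; [exact: mE|exact: measurable_fock_coef].
    + by apply: filterS bD => n h t; rewrite nE.
    + by move=> t; apply: cvgcMl; exact: cvg_disc_coef.
  rewrite /spectral_density coefF.
  have dM := @cvgcMl R ((2 * pi)^-1)%:C _ _ dI.
  apply: (cvg_trans _ dM); apply: near_eq_cvg.
  by apply: filterS nearD => n e; rewrite e.
Qed.
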